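(* Let $\mathbf M$ be an ordered matroid on $S=\{1,\dots,n\}$ (with $1<2<\cdots<n$) with representation $\phi:U\to W$ over a field $\Bbbk$. Then the collection $\{x_B\mid B\in\beta\mathrm{nbc}(\mathbf M^* )\}$ is a basis of the multiplicity space $S_S(\phi)$.
   Context: Setting: $U$ has basis $\{e_i\mid i\in S\}$, $\phi:U\to W$ is a linear map of finite dimensional $\Bbbk$-vector spaces, and $\mathbf M$ has as independent sets those $I\subseteq S$ for which $\phi(e_i)$, $i\in I$, are linearly independent. For $I\subseteq S$: $U_I=\mathrm{span}\{e_i\mid i\in I\}$, $V_I=\mathrm{span}\{\phi(e_i)\mid i\in I\}$, $r(I)=\dim V_I$, $l(I)=|I|-r(I)-1$ (the level). $\mathbf M^*$ is the dual matroid. A T-flat of $\mathbf M$ is a non-empty union of circuits of $\mathbf M$. Multiplicity space: if $S$ is a T-flat of level $l=l(S)$, then $S_S(\phi)\subseteq\mathrm{Sym}^l(V_S)$ is the linear span of all products $w_1\cdots w_l$ with $w_i\in V_{J_i\setminus J_{i-1}}\cap V_{J_{i-1}}$, over all chains $J_0\subset J_1\subset\cdots\subset J_l=S$ of T-flats with $l(J_i)=i$ (for $l=0$ it is $\Bbbk$, spanned by the empty product). If $S$ is not a T-flat, $S_S(\phi)=0$. A broken circuit of $\mathbf M^*$ is a circuit of $\mathbf M^*$ with its smallest element removed. $\beta\mathrm{nbc}(\mathbf M^* )$ is the set of all bases $B$ of $\mathbf M^*$ that contain no broken circuit of $\mathbf M^*$ (such $B$ contain the element $1$) and such that for each $b\in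 B\setminus\{1\}$ one has $b\neq\min c(B,b)$, where $c(B,b)$ is the unique circuit of $\mathbf M$ contained in $(S\setminus B)\cup\{b\}$. The element $x_B$: write $B=\{1<b_1<\cdots<b_l\}$, $l=l(S)$. The chain of T-flats of $\mathbf M$ corresponding to $B$ is $J_0\subset J_1\subset\cdots\subset J_l=S$, where $J_i$ is the union of all circuits of $\mathbf M$ contained in $S\setminus\{b_{i+1},\dots,b_l\}$; it satisfies $1\in J_0$, $l(J_i)=i$ and $\min(J_i\setminus J_{i-1})=b_i$. For $1\le i\le l$ let $p$ be the largest element of $J_i\setminus J_{i-1}$ and let $u_i=e_p+\sum_{j<p}x_je_j$ be the unique element of this form in $U_{J_i\setminus J_{i-1}}$ with $\phi(u_i)\in V_{J_i\setminus J_{i-1}}\cap V_{J_{i-1}}$. Then $x_B=\phi(u_1)\phi(u_2)\cdots\phi(u_l)\in S_S(\phi)$ (the empty product $1$ if $l=0$). *)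

(* Defs.v *)
From HB Require Import structures.
From mathcomp Require Import all_boot all_order all_algebra.
From mathcomp Require classical_sets.
From mathcomp Require Import mpoly.

Set Implicit Arguments.
Unset Strict Implicit.
Unset Printing Implicit Defensive.

Import GRing.Theory.
Local Open Scope ring_scope.

(* A matroid on a finite type is given by its set of independent sets. *)
Section Matroid.
Variable T : finType.
Implicit Types (M : {set {set T}}) (J : {set T}).

Definition bases M : {set {set T}} := [set B | maxset (fun X => X \in M) B].

Definition circuits M : {set {set T}} :=
  [set C | minset (fun X => X \notin M) C].

(* The bases of the dual matroid are the complements of the bases of M, so its
   independent sets are the sets disjoint from some basis of M. *)
Definition dual_matroid M : {set {set T}} :=
  [set X : {set T} | [exists B in bases M, X \subset ~: B]].

Definition Tflat M J : bool :=
  (J != set0) && [exists F : {set {set T}}, (F \subset circuits M) && (J == cover F)].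

Definition circuit_union M (A : {set T}) : {set T} :=
  \bigcup_(C in circuits M | C \subset A) C.

(* The unique circuit c(B,b) of M inside (S \ B) + b, for B a basis of the
   dual matroid and b in B. *)
Definition fund_circuit M (B : {set T}) (b : T) : {set T} :=
  odflt set0 [pick C in circuits M | C \subset b |: ~: B].

End Matroid.

(* The ground set {1 < ... < n+1} is encoded as 'I_n.+1 with its usual order, so
   ord0 stands for the element 1. *)
Section OrderedMatroid.
Variable n : nat.
Implicit Types (M : {set {set 'I_n.+1}}) (A B : {set 'I_n.+1}).

(* The default ord0 is returned only if A is empty. *)
Definition min_elt A : 'I_n.+1 := [arg min_(i < ord0 in A) (i : nat)]%N.
Definition max_elt A : 'I_n.+1 := [arg max_(i > ord0 in A) (i : nat)]%N.

Definition broken_circuits M : {set {set 'I_n.+1}} :=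
  [set C :\ min_elt C | C in circuits M].

(* beta_nbc M is the set "beta nbc of the DUAL of M": the bases B of the dual
   matroid without broken circuits of the dual, and with b <> min c(B,b) for
   b in B other than the first element of the ground set. *)
Definition beta_nbc M : {set {set 'I_n.+1}} :=
  [set B in bases (dual_matroid M) |
     [forall X in broken_circuits (dual_matroid M), ~~ (X \subset B)] &&
     [forall b in B :\ ord0, b != min_elt (fund_circuit M B b)]].

(* Since enum lists ordinals increasingly, enum B = [:: 1; b_1; ...; b_l] and
   dropping its first i+1 entries leaves b_(i+1), ..., b_l. *)
Definition nbc_flat M B (i : nat) : {set 'I_n.+1} :=
  circuit_union M (~: [set b in drop i.+1 (enum B)]).

End OrderedMatroid.

Section LinearAlgebra.
Variables (k : fieldType) (V : lmodType k).

Definition lin_span (P : V -> Prop) (v : V) : Prop :=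
  exists (m : nat) (c : 'I_m -> k) (y : 'I_m -> V),
    (forall i, P (y i)) /\ v = \sum_(i < m) c i *: y i.

(* The family (x i)_(i in A) is a basis of the subspace E. *)
Definition is_basis (I : finType) (A : {set I}) (x : I -> V) (E : V -> Prop) :
    Prop :=
  [/\ forall i, i \in A -> E (x i),
      forall c : I -> k, \sum_(i in A) c i *: x i = 0 ->
        forall i, i \in A -> c i = 0
    & forall v, E v -> exists c : I -> k, v = \sum_(i in A) c i *: x i].

End LinearAlgebra.

(* A basis of V identifies Sym(V) with the polynomial ring in dim V variables,
   the vectors of V being the linear forms; Sym^l(V) is the space of homogeneous
   polynomials of degree l.  The basis used is vbasis {:V}. *)
Section SymmetricPower.
Variables (k : fieldType) (V : vectType k).

Definition Sym (l : nat) : lmodType k := dhomog (\dim {:V}) k l.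

Definition linear_form (v : V) : {mpoly k[\dim {:V}]} :=
  \sum_(j < \dim {:V}) coord (vbasis {:V}) j v *: 'X_j.

Lemma linear_form_dhomog v : linear_form v \is 1.-homog.
Proof.
by apply: rpred_sum => j _; apply: rpredZ; rewrite dhomogX; apply/eqP/mdeg1.
Qed.

Lemma prod_linear_form_dhomog (l : nat) (w : 'I_l -> V) :
  \prod_(i < l) linear_form (w i) \is l.-homog.
Proof.
elim: l w => [|l IHl] w; first by rewrite big_ord0 dhomog1.
rewrite big_ord_recl.
exact: (dhomogM (linear_form_dhomog _) (IHl (fun i => w (lift ord0 i)))).
Qed.

(* The product w_1 ... w_l in Sym^l(V). *)
Definition sym_prod (l : nat) (w : 'I_l -> V) : Sym l :=
  DHomog (prod_linear_form_dhomog w).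

End SymmetricPower.

Section Representation.
Variables (k : fieldType) (U W : vectType k) (n : nat).
Variables (e : n.+1.-tuple U) (phi : 'Hom(U, W)).
Implicit Types I J D : {set 'I_n.+1}.

Definition Uspan I : {vspace U} := <<[seq tnth e i | i <- enum I]>>%VS.
Definition Vspan I : {vspace W} := <<[seq phi (tnth e i) | i <- enum I]>>%VS.

Definition repr_matroid : {set {set 'I_n.+1}} :=
  [set I : {set 'I_n.+1} | free [seq phi (tnth e i) | i <- enum I]].

(* The subtraction is truncated; the true value is negative (namely -1) only for
   independent sets, hence never for T-flats. *)
Definition level I : nat := (#|I| - \dim (Vspan I) - 1)%N.

Local Notation S := [set: 'I_n.+1].
Local Notation M := repr_matroid.
Local Notation VS := (subvs_of (Vspan S)).
Local Notation l := (level S).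

Definition Tflat_chain (J : nat -> {set 'I_n.+1}) : Prop :=
  [/\ forall i, (i <= l)%N -> Tflat M (J i) /\ level (J i) = i,
      forall i, (i < l)%N -> J i \proper J i.+1
    & J l = S].

Definition mult_generator (x : Sym VS l) : Prop :=
  exists (J : nat -> {set 'I_n.+1}) (w : 'I_l -> VS),
    [/\ Tflat_chain J,
        forall i : 'I_l,
          vsval (w i) \in (Vspan (J i.+1 :\: J i) :&: Vspan (J i))%VS
      & x = sym_prod w].

Definition mult_space (x : Sym VS l) : Prop :=
  if Tflat M S then lin_span mult_generator x else x = 0.

(* u = e_p + sum_(j < p) x_j e_j lies in U_D, where D = J' \ J and p = max D, and
   phi u lies in both V_D and V_J. *)
Definition normalized_in (J J' : {set 'I_n.+1}) (u : U) : Prop :=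
  let D := J' :\: J in
  let p := max_elt D in
  [/\ exists x : 'I_n.+1 -> k,
        u = tnth e p + \sum_(j < n.+1 | (j < p)%N) x j *: tnth e j,
      u \in Uspan D
    & phi u \in (Vspan D :&: Vspan J)%VS].

(* nbc_vector B i is u_(i+1): xget picks the unique vector of this form. *)
Definition nbc_vector (B : {set 'I_n.+1}) (i : nat) : U :=
  classical_sets.xget 0 (normalized_in (nbc_flat M B i) (nbc_flat M B i.+1)).

(* vsproj only changes the type: phi u already lies in V_S. *)
Definition nbc_element (B : {set 'I_n.+1}) : Sym VS l :=
  sym_prod (fun i : 'I_l => vsproj (Vspan S) (phi (nbc_vector B i))).

End Representation.

(* Main.v *)
From HB Require Import structures.
Require Import Defs.
From mathcomp Require Import all_boot all_order all_algebra.
From mathcomp Require Import mpoly.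

Set Implicit Arguments.
Unset Strict Implicit.
Unset Printing Implicit Defensive.

Import GRing.Theory.
Local Open Scope ring_scope.

(** Let [v i] be the image of [e i] in the span V of all these images, let S be the
    ground set, and let A be the complement of B, so that A is a basis of the
    matroid when B is one of its dual.  The theorem is a deletion-contraction
    statement for the last element [q] of S.

    Both sides are first freed from flats.  On the combinatorial side, in terms of
    coordinates the beta-nbc condition on B says: in the bipartite graph on A and B
    joining [a] to [b] when [a] can be exchanged for [b] in the basis A, every
    vertex other than the first one has a smaller neighbour ([beta_nbcE]).  Since
    nothing is larger than [q], removing [q] changes nothing for the other vertices.
    If [q] is neither a loop nor a coloop it follows that the beta-nbc bases split
    into those of the deletion of [q] ([q] not in A) and those of the contraction
    ([q] in A).  Up to a nonzero scalar, x_B is the product over b in B, b <> 1, of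
    the part of the expansion of [v b] in A carried by the elements of A that are
    joined to some b' < b ([nbc_element_beta_prod]).  In this form x_B is [v q] times the
    corresponding element of the deletion when [q] is not in A, and it maps to the
    corresponding element of the contraction, in the symmetric algebra of V modulo
    [v q], when [q] is in A.  As Sym(V) is a domain, linear independence follows by
    induction ([beta_below_lin_indep]).

    On the linear side the multiplicity space is contained in the space
    [internal v S] of the polynomials which, for every x in S, are combinations of
    products of the [v j] over complements, in S minus x, of bases avoiding x
    ([generator_internal]).  It suffices that this larger space is spanned by the
    x_B ([internal_span]).  Contraction maps the internal space to the internal
    space of the contraction, where induction applies; after subtracting a
    combination of x_B one is left with an element that vanishes modulo [v q].  Such
    an element is [v q] times an element of the internal space of the deletion, and
    induction applies again.  This last point is exactness in the middle for the
    span of products over complements of bases ([cobasis_span_kernel]); it holds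
    because this span has a basis indexed by the bases without broken circuits:
    they span by straightening ([cobasis_span_nbc]) and are independent by the same
    deletion-contraction argument ([nbc_lin_indep]). *)

(** * Linear algebra of a vector configuration *)

Section Configuration.
Variables (k : fieldType) (V : vectType k) (I : finType).
Implicit Types (v : I -> V) (A Z : {set I}) (T : {vspace V}) (x y : V).

Definition vspan v A : {vspace V} := <<[seq v i | i <- enum A]>>%VS.
Definition vfree v A : bool := free [seq v i | i <- enum A].
Definition is_vbasis v T Z : bool := vfree v Z && (vspan v Z == T).

Definition vtuple v A : #|A|.-tuple V := [tuple v (enum_val j) | j < #|A|].

(** The coordinate of [x] on [v a] in the family [v i], [i \in A]; it is
    meaningful when this family is free and spans [x]. *)
Definition vcoef v A x (a : I) : k :=
  \sum_(j < #|A| | enum_val j == a) coord (vtuple v A) j x.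

Lemma vtupleE v A : vtuple v A = [seq v i | i <- enum A] :> seq V.
Proof.
have -> : enum A = [seq enum_val j | j <- enum 'I_#|A|].
  rewrite (@eq_map _ _ _ (fun j : 'I_#|A| => tnth (enum_tuple A) j)).
    by rewrite map_tnth_enum.
  by move=> j; rewrite (tnth_nth (enum_default j)).
by rewrite -map_comp.
Qed.

Lemma vtuple_nth v A (j : 'I_#|A|) : (vtuple v A)`_j = v (enum_val j).
Proof. by rewrite -tnth_nth tnth_mktuple. Qed.

Lemma vspanP v A x :
  reflect (exists c : I -> k, x = \sum_(i in A) c i *: v i) (x \in vspan v A).
Proof.
rewrite /vspan span_def big_map big_enum /=.
apply: (iffP memv_sumP) => [[f fP ->]|[c ->]]; last first.
  by exists (fun i => c i *: v i) => // i _; apply/vlineP; exists (c i).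
have /fin_all_exists[c cP] : forall i, exists a : k, i \in A -> f i = a *: v i.
  move=> i; case: (boolP (i \in A)) => [iA|_]; last by exists 0.
  by have /vlineP[a] := fP _ iA; exists a.
by exists c; apply: eq_bigr => i /cP.
Qed.

Lemma vfreeP v A :
  reflect (forall c : I -> k, \sum_(i in A) c i *: v i = 0 ->
             forall i, i \in A -> c i = 0) (vfree v A).
Proof.
rewrite /vfree -vtupleE; apply: (iffP freeP) => H c.
  rewrite big_enum_val /= => E i iA.
  rewrite -(enum_rankK_in iA iA); apply: (H (fun j => c (enum_val j))).
  by under eq_bigr do rewrite vtuple_nth.
move=> E i.
pose d a := \sum_(j < #|A| | enum_val j == a) c j.
have dE j : d (enum_val j) = c j.
  rewrite /d (big_pred1 j) // => j'.
  by rewrite (inj_eq enum_val_inj).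
rewrite -dE; apply: H (enum_valP i); rewrite big_enum_val /=.
by rewrite -[RHS]E; apply: eq_bigr => j _; rewrite dE vtuple_nth.
Qed.

Lemma memv_vspan v A i : i \in A -> v i \in vspan v A.
Proof. by move=> iA; apply: memv_span; apply: map_f; rewrite mem_enum. Qed.

Lemma vspan_sub v A T : (forall i, i \in A -> v i \in T) -> (vspan v A <= T)%VS.
Proof.
move=> H; apply/span_subvP => x /mapP[i]; rewrite mem_enum => iA ->.
exact: H.
Qed.

Lemma vspanS v A Z : A \subset Z -> (vspan v A <= vspan v Z)%VS.
Proof.
by move=> /subsetP AZ; apply: vspan_sub => i /AZ; apply: memv_vspan.
Qed.

Lemma vfreeS v A Z : A \subset Z -> vfree v Z -> vfree v A.
Proof.
move=> /subsetP AZ /vfreeP H; apply/vfreeP => c E i iA.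
have := H (fun i => if i \in A then c i else 0) _ i (AZ _ iA); rewrite iA; apply.
rewrite -[RHS]E (bigID (mem A)) /= [X in _ + X]big1 ?addr0; last first.
  by move=> j /andP[_ /negbTE->]; rewrite scale0r.
apply: eq_big => [j|j /andP[_ ->] //].
by case: (boolP (j \in A)) => [/AZ->|]; rewrite ?andbF.
Qed.

Lemma dim_vspan v A : (\dim (vspan v A) <= #|A|)%N.
Proof. by rewrite /vspan cardE -(size_map v) dim_span. Qed.

Lemma vfree_dim v A : vfree v A = (\dim (vspan v A) == #|A|).
Proof. by rewrite /vfree /free /vspan size_map -cardE. Qed.

Lemma vspan_vcoef v A x :
  x \in vspan v A -> x = \sum_(a in A) vcoef v A x a *: v a.
Proof.
rewrite /vspan -vtupleE => xE; rewrite {1}(coord_span xE) [RHS]big_enum_val /=.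
apply: eq_bigr => j _; rewrite vtuple_nth; congr (_ *: _).
by rewrite /vcoef (big_pred1 j) // => j'; rewrite (inj_eq enum_val_inj).
Qed.

Lemma vcoef_unique v A x (c : I -> k) :
  vfree v A -> x = \sum_(a in A) c a *: v a ->
  forall a, a \in A -> vcoef v A x a = c a.
Proof.
move=> /vfreeP fA xE a aA; apply/eqP; rewrite -subr_eq0; apply/eqP.
apply: (fA (fun a => vcoef v A x a - c a) _ a aA).
under eq_bigr do rewrite scalerBl.
rewrite sumrB -xE -vspan_vcoef ?subrr //.
by apply/vspanP; exists c.
Qed.

Lemma vcoefD v A x y a : vcoef v A (x + y) a = vcoef v A x a + vcoef v A y a.
Proof. by rewrite /vcoef -big_split; apply: eq_bigr => j _; rewrite linearD. Qed.

Lemma vcoefZ v A c x a : vcoef v A (c *: x) a = c * vcoef v A x a.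
Proof. by rewrite /vcoef mulr_sumr; apply: eq_bigr => j _; rewrite linearZ. Qed.

Lemma vcoef0 v A a : vcoef v A 0 a = 0.
Proof. by rewrite /vcoef big1 // => j _; rewrite linear0. Qed.

Lemma vcoef_sum v A (J : finType) (P : pred J) (F : J -> V) a :
  vcoef v A (\sum_(j | P j) F j) a = \sum_(j | P j) vcoef v A (F j) a.
Proof.
apply: (big_morph (fun x => vcoef v A x a)) => [x y|]; first exact: vcoefD.
exact: vcoef0.
Qed.

Lemma vcoef_in v A b a :
  vfree v A -> b \in A -> a \in A -> vcoef v A (v b) a = (a == b)%:R.
Proof.
move=> fA bA; apply: (vcoef_unique (c := fun a => (a == b)%:R)) => //.
rewrite (bigD1 b) //= eqxx scale1r big1 ?addr0 // => i /andP[_ /negbTE->].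
by rewrite scale0r.
Qed.

Lemma vcoef_span0 v A x Z a :
  (forall i, i \in Z -> vcoef v A (v i) a = 0) -> x \in vspan v Z ->
  vcoef v A x a = 0.
Proof.
move=> H /vspanP[c ->]; rewrite vcoef_sum big1 // => i iZ.
by rewrite vcoefZ H ?mulr0.
Qed.

Lemma is_vbasisP v T Z : is_vbasis v T Z -> vfree v Z * (vspan v Z = T).
Proof. by case/andP => -> /eqP->. Qed.

Lemma is_vbasis_card v T Z : is_vbasis v T Z -> #|Z| = \dim T.
Proof. by case/is_vbasisP => + <-; rewrite vfree_dim => /eqP. Qed.

Lemma is_vbasis_spanE v T Z :
  (T <= vspan v Z)%VS -> (#|Z| <= \dim T)%N -> is_vbasis v T Z.
Proof.
move=> TZ cZ.
have eT : vspan v Z = T.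
  apply/esym/eqP; rewrite eqEdim TZ /=.
  exact: leq_trans (dim_vspan _ _) cZ.
rewrite /is_vbasis eT eqxx andbT vfree_dim eT eqn_leq cZ andbT.
by rewrite -eT dim_vspan.
Qed.

(** The expansion of [v x] can be solved for [v z], whose coefficient is
    invertible. *)
Lemma is_vbasis_exchange v T Z (x z : I) :
  is_vbasis v T Z -> z \in Z -> x \notin Z -> v x \in T ->
  vcoef v Z (v x) z != 0 -> is_vbasis v T (x |: (Z :\ z)).
Proof.
move=> bZ zZ xZ xT cx; have [fZ sZ] := is_vbasisP bZ.
apply: is_vbasis_spanE; last first.
  rewrite -(is_vbasis_card bZ) cardsU1 !inE (negPf xZ) andbF.
  by rewrite (cardsD1 z Z) zZ.
rewrite -sZ; apply: vspan_sub => i iZ.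
have [->|iz] := eqVneq i z; last by apply: memv_vspan; rewrite !inE iz iZ orbT.
have E : v x = \sum_(a in Z) vcoef v Z (v x) a *: v a.
  by apply: vspan_vcoef; rewrite sZ.
have -> : v z = (vcoef v Z (v x) z)^-1 *:
    (v x - \sum_(a in Z :\ z) vcoef v Z (v x) a *: v a).
  rewrite {2}E (big_setD1 z) //= addrK scalerA mulVf ?scale1r //.
apply: memvZ; apply: memvB; first by apply: memv_vspan; rewrite !inE eqxx.
apply: rpred_sum => a aZ; apply: memvZ; apply: memv_vspan.
by rewrite in_setU aZ orbT.
Qed.

Lemma vfreeU1 v A (x : I) :
  vfree v A -> v x \notin vspan v A -> vfree v (x |: A).
Proof.
move=> /vfreeP fA xA; have xnA : x \notin A by apply: contra xA; apply: memv_vspan.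
apply/vfreeP => c; rewrite big_setU1 //= => E.
have c0 : c x = 0.
  apply/eqP; apply: contraR xA => cx.
  have -> : v x = (- (c x)^-1) *: \sum_(i in A) c i *: v i.
    move/eqP: E; rewrite addrC addr_eq0 => /eqP->.
    by rewrite scalerN scaleNr opprK scalerA mulVf ?scale1r.
  by apply: memvZ; apply/vspanP; exists c.
move: E; rewrite c0 scale0r add0r => /fA H i; rewrite !inE => /orP[/eqP->//|].
exact: H.
Qed.

Lemma vfreeU1_notin v A (x : I) :
  x \notin A -> vfree v (x |: A) -> v x \notin vspan v A.
Proof.
move=> xA fA; apply/negP => /vcoef_span0 H.
have := vcoef_in fA (setU11 x A) (setU11 x A); rewrite eqxx H.
  by move/eqP; rewrite eq_sym oner_eq0.
move=> i iA; rewrite vcoef_in ?setU11 ?inE ?iA ?orbT //.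
by case: eqP xA iA => // -> /negP.
Qed.

Lemma vspanU1_dep v A (x : I) : v x \in vspan v A -> vspan v (x |: A) = vspan v A.
Proof.
move=> xA; apply/eqP; rewrite eqEsubv (vspanS v (subsetUr [set x] A)) andbT.
apply: vspan_sub => i; rewrite !inE => /orP[/eqP->//|]; exact: memv_vspan.
Qed.

Lemma vspan_setU v A Z : vspan v (A :|: Z) = (vspan v A + vspan v Z)%VS.
Proof.
apply/eqP; rewrite eqEsubv; apply/andP; split.
  apply: vspan_sub => i; rewrite inE => /orP[] /(memv_vspan v).
    exact/subvP/addvSl.
  exact/subvP/addvSr.
by rewrite subv_add !vspanS ?subsetUl ?subsetUr.
Qed.

End Configuration.

(** * Spans of finite families *)

Section FiniteSpan.
Variables (k : fieldType) (R : lmodType k) (X : finType).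
Implicit Types (P : pred X).

Definition inspan P (g : X -> R) (f : R) : Prop :=
  exists c : X -> k, f = \sum_(z | P z) c z *: g z.

Lemma inspan0 P (g : X -> R) : inspan P g 0.
Proof. by exists (fun=> 0); rewrite big1 // => z _; rewrite scale0r. Qed.

Lemma inspanD P (g : X -> R) f f' :
  inspan P g f -> inspan P g f' -> inspan P g (f + f').
Proof.
move=> [c ->] [c' ->]; exists (fun z => c z + c' z).
by rewrite -big_split; apply: eq_bigr => z _; rewrite scalerDl.
Qed.

Lemma inspanZ P (g : X -> R) a f : inspan P g f -> inspan P g (a *: f).
Proof.
move=> [c ->]; exists (fun z => a * c z).
by rewrite scaler_sumr; apply: eq_bigr => z _; rewrite scalerA.
Qed.

Lemma inspan_gen P (g : X -> R) z : P z -> inspan P g (g z).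
Proof.
move=> Pz; exists (fun z' => (z' == z)%:R).
rewrite (bigD1 z) //= eqxx scale1r big1 ?addr0 // => i /andP[_ /negbTE->].
by rewrite scale0r.
Qed.

Lemma inspan_sum P (g : X -> R) (J : finType) (p : pred J) (F : J -> R) :
  (forall j, p j -> inspan P g (F j)) -> inspan P g (\sum_(j | p j) F j).
Proof.
move=> H; elim/big_ind: _ => //; [exact: inspan0 | exact: inspanD].
Qed.

End FiniteSpan.

Lemma inspan_linear (k : fieldType) (R R' : lmodType k) (X Y : finType)
    (P : pred X) (g : X -> R) (Q : pred Y) (h : Y -> R')
    (F : {linear R -> R'}) (f : R) :
  (forall z, P z -> inspan Q h (F (g z))) -> inspan P g f -> inspan Q h (F f).
Proof.
move=> H [c ->]; rewrite linear_sum; apply: inspan_sum => z Pz.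
by rewrite linearZ; apply: inspanZ; apply: H.
Qed.

Lemma inspan_mull (k : fieldType) (R : algType k) (X Y : finType)
    (P : pred X) (g : X -> R) (Q : pred Y) (h : Y -> R) (a f : R) :
  (forall z, P z -> inspan Q h (a * g z)) -> inspan P g f -> inspan Q h (a * f).
Proof.
move=> H [c ->]; rewrite mulr_sumr; apply: inspan_sum => z Pz.
by rewrite -scalerAr; apply: inspanZ; apply: H.
Qed.

(** * Linear forms and contraction *)

Section LinearForms.
Variables (k : fieldType) (V : vectType k).
Local Notation R := {mpoly k[\dim {:V}]}.
Local Notation lf := (@linear_form k V).
Implicit Types (x y : V) (f g : R).

Fact linear_form_is_linear : linear lf.
Proof.
move=> a x y; rewrite /linear_form scaler_sumr -big_split; apply: eq_bigr => j _.
by rewrite linearP scalerDl scalerA.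
Qed.
HB.instance Definition _ :=
  GRing.isLinear.Build k V R *:%R lf linear_form_is_linear.

Lemma linear_form_eq0 x : (lf x == 0) = (x == 0).
Proof.
apply/eqP/eqP => [E|->]; last exact: linear0.
have fB := basis_free (vbasisP {:V}).
rewrite (coord_vbasis (memvf x)) big1 // => j _.
have : (lf x)@_U_(j) = 0 by rewrite E mcoeff0.
rewrite /linear_form raddf_sum /= (bigD1 j) //= mcoeffZ mcoeffXU eqxx mulr1.
rewrite big1 ?addr0 => [->|i ij]; first by rewrite scale0r.
by rewrite mcoeffZ mcoeffXU (negPf ij) mulr0.
Qed.

(** The quotient by the line of [y] is realised inside [V], as the image of a
    projection along [y], so that contraction does not change the polynomial ring;
    [pcontr y] is the algebra endomorphism induced by this projection. *)
Definition contr y : 'End(V) := (\1 - projv <[y]>)%VF.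

Definition pcontr y : R -> R :=
  comp_mpoly [tuple lf (contr y (vbasis {:V})`_j) | j < \dim {:V}].

HB.instance Definition _ y := GRing.LRMorphism.copy (pcontr y)
  (comp_mpoly [tuple lf (contr y (vbasis {:V})`_j) | j < \dim {:V}]).

Lemma contrE y x : contr y x = x - projv <[y]> x.
Proof. by rewrite add_lfunE opp_lfunE id_lfunE. Qed.

Lemma contr_id y : contr y y = 0.
Proof. by rewrite contrE projv_id ?memv_line ?subrr. Qed.

Lemma contr_eq0 y x : contr y x = 0 -> x \in <[y]>%VS.
Proof. by rewrite contrE => /eqP; rewrite subr_eq0 => /eqP->; apply: memv_proj. Qed.

Lemma pcontr_lf y x : pcontr y (lf x) = lf (contr y x).
Proof.
rewrite {2}(coord_vbasis (memvf x)) {1}/linear_form !linear_sum.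
apply: eq_bigr => j _; rewrite !linearZ /=; congr (_ *: _).
by rewrite /pcontr comp_mpolyXU -[LHS]tnth_nth tnth_mktuple.
Qed.

End LinearForms.

Section Contraction.
Variables (k : fieldType) (V : vectType k) (I : finType).
Implicit Types (v : I -> V) (A Z : {set I}) (T : {vspace V}) (q : I).

Definition contrv v q (i : I) : V := contr (v q) (v i).

Lemma vspan_contr v q A :
  vspan (contrv v q) A = (contr (v q) @: vspan v A)%VS.
Proof. by rewrite /vspan limg_span -map_comp. Qed.

Lemma memv_contr v q T x :
  v q \in T -> contr (v q) x \in (contr (v q) @: T)%VS -> x \in T.
Proof.
move=> qT /memv_imgP[u uT /eqP]; rewrite -subr_eq0 -linearB => /eqP/contr_eq0.
move=> /vlineP[a /eqP]; rewrite subr_eq => /eqP->.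
by apply: memvD => //; apply: memvZ.
Qed.

Lemma vfree_contr v q Z :
  v q != 0 -> q \notin Z -> vfree (contrv v q) Z = vfree v (q |: Z).
Proof.
move=> q0 qZ; apply/vfreeP/vfreeP => H c.
  rewrite big_setU1 //= => E.
  have cZ : forall i, i \in Z -> c i = 0.
    apply: H; transitivity (contr (v q) (c q *: v q + \sum_(i in Z) c i *: v i)).
      rewrite linearD linearZ /= contr_id scaler0 add0r linear_sum.
      by apply: eq_bigr => i _; rewrite linearZ.
    by rewrite E linear0.
  move: E; rewrite big1 ?addr0 => [/eqP|i /cZ->]; last by rewrite scale0r.
  rewrite scaler_eq0 (negPf q0) orbF => /eqP cq i; rewrite !inE.
  by case/orP => [/eqP->|/cZ].
move=> E.
have /contr_eq0/vlineP[a aE] : contr (v q) (\sum_(i in Z) c i *: v i) = 0.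
  by rewrite linear_sum -[RHS]E; apply: eq_bigr => i _; rewrite linearZ.
have neq i : i \in Z -> (i == q) = false.
  by move=> iZ; apply: contraNF qZ => /eqP<-.
move=> i iZ; have := H (fun i => if i == q then - a else c i) _ i.
rewrite neq //; apply; last by rewrite inE iZ orbT.
rewrite big_setU1 //= eqxx scaleNr -aE addrC; apply/eqP; rewrite subr_eq0.
by apply/eqP/eq_bigr => j /neq->.
Qed.

Lemma is_vbasis_contr v q T Z :
  v q != 0 -> v q \in T -> q \notin Z ->
  is_vbasis (contrv v q) (contr (v q) @: T) Z = is_vbasis v T (q |: Z).
Proof.
move=> q0 qT qZ; rewrite /is_vbasis vfree_contr //; congr (_ && _).
have -> : vspan (contrv v q) Z = (contr (v q) @: vspan v (q |: Z))%VS.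
  rewrite -vspan_contr; apply/eqP; rewrite eqEsubv vspanS ?subsetUr //=.
  apply: vspan_sub => i; rewrite !inE => /orP[/eqP->|]; last exact: memv_vspan.
  by rewrite /contrv contr_id mem0v.
apply/eqP/eqP => [E|-> //].
apply/eqP; rewrite eqEsubv; apply/andP; split; apply/subvP => x xT.
  by apply: (memv_contr qT); rewrite -E; apply: memv_img.
apply: (@memv_contr v q); first by apply: memv_vspan; rewrite !inE eqxx.
by rewrite E; apply: memv_img.
Qed.

Lemma vcoef_contr v q Z x z :
  v q != 0 -> q \notin Z -> vfree v (q |: Z) -> x \in vspan v (q |: Z) ->
  z \in Z -> vcoef (contrv v q) Z (contr (v q) x) z = vcoef v (q |: Z) x z.
Proof.
move=> q0 qZ fZ xZ zZ; apply: (vcoef_unique (c := vcoef v (q |: Z) x)) => //.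
  by rewrite vfree_contr.
rewrite {1}(vspan_vcoef xZ) big_setU1 //= linearD linearZ /= contr_id scaler0.
by rewrite add0r linear_sum; apply: eq_bigr => i _; rewrite linearZ.
Qed.

End Contraction.

(** * Deletion and contraction of linear independence *)

Section DeletionContraction.
Variables (k : fieldType) (V : vectType k) (I : finType).
Local Notation R := {mpoly k[\dim {:V}]}.
Local Notation lf := (@linear_form k V).

Definition lin_indep (E : lmodType k) (X : finType) (P : pred X) (g : X -> E) : Prop :=
  forall c : X -> k, \sum_(z | P z) c z *: g z = 0 -> forall z, P z -> c z = 0.

Lemma sum_setU1 (E : nmodType) (q : I) (P : pred {set I}) (F : {set I} -> E) :
  \sum_(Z | P Z && (q \in Z)) F Z =
  \sum_(Z | P (q |: Z) && (q \notin Z)) F (q |: Z).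
Proof.
rewrite (reindex_onto (fun Z => q |: Z) (fun Z => Z :\ q)) /=; last first.
  by move=> Z /andP[_]; apply: setD1K.
apply: eq_bigl => Z; rewrite setU11 andbT; congr (_ && _).
apply/eqP/idP => [<-|qZ]; first by rewrite !inE eqxx.
by rewrite setU1K.
Qed.

Variables (q : I) (y : V) (P P1 P2 : pred {set I}) (g g1 g2 : {set I} -> R).
(* The members of the family [g] that avoid [q] come from the deletion [g1] by
   multiplication with [y]; those that contain it map to the contraction [g2]. *)
Hypotheses (y0 : y != 0)
  (del : forall Z : {set I}, q \notin Z -> P Z -> P1 Z /\ g Z = lf y * g1 Z)
  (con : forall Z : {set I}, q \notin Z -> P (q |: Z) ->
     P2 Z /\ pcontr y (g (q |: Z)) = g2 Z).

Let lfy0 : lf y != 0. Proof. by rewrite linear_form_eq0. Qed.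

Lemma pcontr_self : pcontr y (lf y) = 0.
Proof. by rewrite pcontr_lf contr_id linear0. Qed.

(** The members of the family avoiding [q] are multiples of [y] and die in the
    contraction, where the others remain independent. *)
Lemma lin_indep_contr (c : {set I} -> k) :
  lin_indep P2 g2 -> pcontr y (\sum_(Z | P Z) c Z *: g Z) = 0 ->
  forall Z, P Z -> q \in Z -> c Z = 0.
Proof.
move=> ind E.
pose b Z := P (q |: Z) && (q \notin Z).
pose c2 Z := if b Z then c (q |: Z) else 0.
have E2 : \sum_(Z | P2 Z) c2 Z *: g2 Z = 0.
  rewrite -[RHS]E [in RHS](bigID (fun Z : {set I} => q \in Z)) /= linearD /= [X in _ + X]linear_sum.
  rewrite [X in _ + X]big1 ?addr0 => [|Z /andP[PZ qZ]]; last first.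
    by have [_ ->] := del qZ PZ; rewrite linearZ /= rmorphM /= pcontr_self mul0r scaler0.
  rewrite sum_setU1 linear_sum big_mkcond [RHS]big_mkcond; apply: eq_bigr => Z _.
  rewrite -/(b Z) /c2; have [bZ|_] := boolP (b Z); last first.
    by case: ifP => // _; rewrite scale0r.
  case/andP: bZ => PZ qZ; have [-> <-] := con qZ PZ.
  by rewrite linearZ.
move=> Z PZ qZ; have := ind _ E2 (Z :\ q); rewrite /c2 /b setD1K // PZ.
by rewrite !inE eqxx /=; apply; apply: (con _ _).1; rewrite ?setD1K // !inE eqxx.
Qed.

(** A relation loses its terms containing [q] in the contraction; what is left is
    divisible by [y], and the quotient is a relation in the deletion. *)
Lemma lin_indep_del_contr : lin_indep P1 g1 -> lin_indep P2 g2 -> lin_indep P g.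
Proof.
move=> ind1 ind2 c E.
have cq : forall Z, P Z -> q \in Z -> c Z = 0.
  by apply: lin_indep_contr => //; rewrite E rmorph0.
pose b Z := P Z && (q \notin Z).
pose c1 Z := if b Z then c Z else 0.
have E1 : \sum_(Z | P1 Z) c1 Z *: g1 Z = 0.
  apply: (mulfI lfy0); rewrite mulr0 -[RHS]E mulr_sumr.
  rewrite [in RHS](bigID (fun Z : {set I} => q \in Z)) /= [X in _ = X + _]big1 ?add0r; last first.
    by move=> Z /andP[PZ qZ]; rewrite cq // scale0r.
  rewrite big_mkcond [RHS]big_mkcond; apply: eq_bigr => Z _.
  rewrite -/(b Z) /c1; have [bZ|_] := boolP (b Z); last first.
    by case: ifP => // _; rewrite scale0r mulr0.
  case/andP: bZ => PZ qZ; have [-> ->] := del qZ PZ.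
  by rewrite scalerAr.
move=> Z PZ; have [qZ|qZ] := boolP (q \in Z); first exact: cq.
have := ind1 _ E1 Z; rewrite /c1 /b PZ qZ; apply.
by have [] := del qZ PZ.
Qed.

End DeletionContraction.

(** * Products over complements of bases *)

Section CobasisProducts.
Variables (k : fieldType) (V : vectType k) (N : nat).
Local Notation I := 'I_N.
Local Notation R := {mpoly k[\dim {:V}]}.
Local Notation lf := (@linear_form k V).
Implicit Types (v : I -> V) (A Z : {set I}) (T : {vspace V}) (q : I) (f g : R).

Definition vprod v A : R := \prod_(i in A) lf (v i).

(** The space [T] is kept apart from [A] because deleting an element of [A] must
    not change it: the span is zero as soon as [A] no longer generates [T]. *)
Definition cobasis_span v T A f : Prop :=
  inspan [pred Z : {set I} | (Z \subset A) && is_vbasis v T Z]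
    (fun Z => vprod v (A :\: Z)) f.

(** A basis [Z] contains no broken circuit exactly when it has external activity
    zero: no [a] outside [Z] is the smallest element of its fundamental circuit. *)
Definition nbc v T A Z : bool :=
  [&& Z \subset A, is_vbasis v T Z &
    [forall a in A :\: Z, [exists z in Z, (z < a)%N && (vcoef v Z (v a) z != 0)]]].

Lemma vprod_contr v q A : pcontr (v q) (vprod v A) = vprod (contrv v q) A.
Proof. by rewrite rmorph_prod; apply: eq_bigr => i _; apply: pcontr_lf. Qed.

Lemma vprod_setD1 v A q : q \in A -> vprod v A = lf (v q) * vprod v (A :\ q).
Proof. by move=> qA; rewrite /vprod (big_setD1 q). Qed.

Lemma set_max A : A != set0 -> exists2 q, q \in A & forall i, i \in A -> (i <= q)%N.
Proof.
case/set0Pn => q0 q0A.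
case: (arg_maxnP (P := mem A) (fun i : I => i : nat) q0A) => q qA qmax.
by exists q.
Qed.

(** Straightening: if [a] precedes its fundamental circuit in [Z], expanding
    [v a] in the basis [Z] replaces [Z] by bases with a smaller element sum. *)
Lemma cobasis_span_nbc v T A f :
  (forall a, a \in A -> v a \in T) -> cobasis_span v T A f ->
  inspan (nbc v T A) (fun Z => vprod v (A :\: Z)) f.
Proof.
move=> AT [c ->]; apply: inspan_sum => Z /andP[ZA bZ]; apply: inspanZ.
have [m] := ubnP (\sum_(z in Z) z)%N.
elim: m Z ZA bZ => // m IH Z ZA bZ Zm.
have [nZ|] := boolP (nbc v T A Z); first exact: (inspan_gen _ nZ).
rewrite /nbc ZA bZ /= => /forall_inPn[a].
rewrite inE => /andP[aZ aA] /exists_inPn Ha.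
have [fZ sZ] := is_vbasisP bZ.
have aE : v a = \sum_(z in Z) vcoef v Z (v a) z *: v z.
  by apply: vspan_vcoef; rewrite sZ AT.
rewrite (@vprod_setD1 _ _ a) ?inE ?aZ // aE linear_sum mulr_suml.
apply: inspan_sum => z zZ; rewrite linearZ /= -scalerAl.
have [->|cz] := eqVneq (vcoef v Z (v a) z) 0.
  by rewrite scale0r; apply: inspan0.
apply: inspanZ.
have az : (a < z)%N.
  have := Ha z zZ; rewrite cz andbT -leqNgt leq_eqVlt.
  by case/orP => // /eqP/val_inj E; rewrite -E (negPf aZ) in zZ || rewrite E zZ in aZ.
have zA : z \in A := subsetP ZA z zZ.
have za : z == a = false by apply: contraTF az => /eqP->; rewrite ltnn.
have -> : lf (v z) * vprod v ((A :\: Z) :\ a) = vprod v (A :\: (a |: (Z :\ z))).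
  rewrite (@vprod_setD1 _ (_ :\: (_ |: _)) z) ?inE ?eqxx ?za ?andbF ?orbF //.
  congr (_ * vprod _ _); apply/setP => i; rewrite !inE.
  have [->|] := eqVneq i z; first by rewrite zZ andbF.
  by have [->|] := eqVneq i a; rewrite ?(negPf aZ).
apply: IH.
- apply/subsetP => i; rewrite !inE => /orP[/eqP->//|/andP[_ /(subsetP ZA)//]].
- by apply: is_vbasis_exchange => //; apply: AT.
rewrite big_setU1 ?inE ?(negPf aZ) ?andbF //=.
rewrite (big_setD1 z) //= ltnS in Zm; apply: leq_trans Zm.
by rewrite ltn_add2r.
Qed.

Lemma nbc_delete v T A Z q :
  q \in A -> q \notin Z -> nbc v T A Z ->
  nbc v T (A :\ q) Z /\ vprod v (A :\: Z) = lf (v q) * vprod v ((A :\ q) :\: Z).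
Proof.
move=> qA qZ /and3P[ZA bZ /forall_inP H]; split.
  apply/and3P; split=> //; first by rewrite subsetD1 ZA.
  by apply/forall_inP => a; rewrite !inE => /and3P[aZ _ aA]; apply: H; rewrite inE aZ.
rewrite (@vprod_setD1 _ _ q) ?inE ?qA ?qZ //; congr (_ * vprod _ _).
by apply/setP => i; rewrite !inE andbCA.
Qed.

Lemma nbc_contract v T A Z q :
  (forall i, i \in A -> (i <= q)%N) -> (forall i, i \in A -> v i \in T) ->
  v q != 0 -> q \notin Z -> nbc v T A (q |: Z) ->
  nbc (contrv v q) (contr (v q) @: T) (A :\ q) Z /\
  pcontr (v q) (vprod v (A :\: (q |: Z))) = vprod (contrv v q) ((A :\ q) :\: Z).
Proof.
move=> qmax AT q0 qZ /and3P[ZA bZ /forall_inP H]; split; last first.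
  by rewrite vprod_contr; congr vprod; apply/setP => i; rewrite !inE negb_or -andbA andbCA.
have qA : q \in A by apply: (subsetP ZA); rewrite !inE eqxx.
have [fZ sZ] := is_vbasisP bZ.
apply/and3P; split.
- rewrite subsetD1 qZ andbT; apply: subset_trans ZA; exact: subsetUr.
- by rewrite is_vbasis_contr // AT.
apply/forall_inP => a; rewrite !inE => /and3P[aZ aq aA].
have aAZ : a \in A :\: (q |: Z) by rewrite !inE negb_or aq aZ aA.
have /exists_inP[z] := H a aAZ; rewrite !inE.
case/orP => [/eqP->|zZ] /andP[za cz].
  by have := qmax a aA; rewrite leqNgt za.
by apply/exists_inP; exists z => //; rewrite za /= vcoef_contr // sZ AT.
Qed.

Lemma nbc_loop v T A Z q :
  (forall i, i \in A -> (i <= q)%N) -> q \in A -> v q = 0 -> ~~ nbc v T A Z.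
Proof.
move=> qmax qA q0; apply/negP => /and3P[ZA bZ /forall_inP H].
have [fZ _] := is_vbasisP bZ.
have [qZ|qZ] := boolP (q \in Z).
  move: fZ; rewrite -(setD1K qZ) => /(vfreeU1_notin _).
  by rewrite !inE eqxx q0 mem0v => /(_ isT).
have qAZ : q \in A :\: Z by rewrite inE qA qZ.
have /exists_inP[z _] := H q qAZ.
by rewrite q0 vcoef0 eqxx andbF.
Qed.

Lemma nbc_lin_indep v T A :
  (forall a, a \in A -> v a \in T) ->
  lin_indep (nbc v T A) (fun Z => vprod v (A :\: Z)).
Proof.
have [m] := ubnP #|A|; elim: m v T A => // m IH v T A Am AT.
have [A0|/set_max[q qA qmax]] := eqVneq A set0.
  move=> c; have H Z : nbc v T A Z -> Z = set0.
    by rewrite A0 => /and3P[]; rewrite subset0 => /eqP.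
  move=> E Z PZ; have Z0 := H Z PZ; rewrite Z0 in PZ *; move: E.
  rewrite (bigD1 set0) //= big1 ?addr0; last first.
    by move=> Z' /andP[/H->]; rewrite eqxx.
  rewrite A0 setD0 /vprod big_set0 => /eqP.
  by rewrite scaler_eq0 oner_eq0 orbF => /eqP.
have [q0|q0] := eqVneq (v q) 0.
  by move=> c _ Z; rewrite (negPf (nbc_loop _ _ qmax qA q0)).
have Aq : (#|A :\ q| < m)%N by rewrite (cardsD1 q A) qA in Am.
have sub i : i \in A :\ q -> i \in A by rewrite inE => /andP[].
apply: (lin_indep_del_contr q0).
- by move=> Z qZ; apply: nbc_delete qZ.
- by move=> Z qZ; apply: nbc_contract.
- by apply: IH => // i /sub/AT.
apply: IH => // i /sub iA; apply: memv_img; exact: AT.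
Qed.

(** Exactness in the middle of the deletion-contraction sequence.  In the
    expansion of [f] over bases without broken circuits, the bases containing [q]
    stay independent in the contraction, so their coefficients vanish; the other
    products are visibly multiples of [v q]. *)
Lemma cobasis_span_kernel v T A q f :
  (forall i, i \in A -> (i <= q)%N) -> (forall i, i \in A -> v i \in T) ->
  v q != 0 -> q \in A -> cobasis_span v T A f -> pcontr (v q) f = 0 ->
  exists2 g, cobasis_span v T (A :\ q) g & f = lf (v q) * g.
Proof.
move=> qmax AT q0 qA /(cobasis_span_nbc AT)[c ->] E.
have del Z : q \notin Z -> nbc v T A Z -> _ := fun h => nbc_delete qA h.
have con Z : q \notin Z -> nbc v T A (q |: Z) -> _ := nbc_contract qmax AT q0.
have AT' i : i \in A :\ q -> contrv v q i \in (contr (v q) @: T)%VS.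
  by rewrite inE => /andP[_ /AT]; apply: memv_img.
have cq := lin_indep_contr del con (nbc_lin_indep AT') E.
exists (\sum_(Z | nbc v T A Z && (q \notin Z)) c Z *: vprod v ((A :\ q) :\: Z)).
  apply: inspan_sum => Z /andP[nZ qZ]; apply: inspanZ.
  have [/and3P[ZA bZ _] _] := del Z qZ nZ.
  by apply: (inspan_gen (P := [pred Z | _ & _])); rewrite /= ZA.
rewrite (bigID (fun Z : {set I} => q \in Z)) /= big1 ?add0r; last first.
  by move=> Z /andP[nZ qZ]; rewrite cq ?scale0r.
rewrite mulr_sumr; apply: eq_bigr => Z /andP[nZ qZ].
by have [_ ->] := del Z qZ nZ; rewrite scalerAr.
Qed.

End CobasisProducts.

(** * The flats attached to a basis *)

Section Flats.
Variables (k : fieldType) (V : vectType k) (I : finType).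
Implicit Types (v : I -> V) (A B C : {set I}) (T : {vspace V}).

(** For a basis [A] and [C] disjoint from it, [flat v A C] is the union of the
    fundamental circuits of the elements of [C], and [reach v A C] is its trace
    on [A]. *)
Definition reach v A C : {set I} :=
  [set a in A | [exists b in C, vcoef v A (v b) a != 0]].
Definition flat v A C : {set I} := C :|: reach v A C.

(** For [b] outside [A] and [C], this vector generates the intersection of the
    span of the flat of [C] with the span of the elements that [b] adds to this
    flat. *)
Definition wvec v A C b : V :=
  \sum_(a in reach v A C) vcoef v A (v b) a *: v a.

Lemma vcoef_sub v A A' x a :
  A' \subset A -> vfree v A -> x \in vspan v A' -> a \in A' ->
  vcoef v A' x a = vcoef v A x a.
Proof.
move=> sA fA xA' aA'.
rewrite (@vcoef_unique _ _ _ v A x (fun i => if i \in A' then vcoef v A' x i else 0)) //.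
- by rewrite aA'.
- rewrite {1}(vspan_vcoef xA') [RHS](bigID (mem A')) /= [X in _ + X]big1 ?addr0.
    apply: eq_big => [i|i ->] //.
    by case: (boolP (i \in A')) => [/(subsetP sA)->|]; rewrite ?andbF.
  by move=> i /andP[_ /negbTE->]; rewrite scale0r.
exact: (subsetP sA).
Qed.

Lemma reach_sub v A C : reach v A C \subset A.
Proof. by apply/subsetP => a; rewrite inE => /andP[]. Qed.

Lemma reachS v A C C' : C \subset C' -> reach v A C \subset reach v A C'.
Proof.
move=> /subsetP CC'; apply/subsetP => a; rewrite !inE => /andP[-> /=].
by case/exists_inP => b /CC' bC' cb; apply/exists_inP; exists b.
Qed.

Lemma flatS v A C C' : C \subset C' -> flat v A C \subset flat v A C'.
Proof. by move=> CC'; rewrite setUSS // reachS. Qed.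

Section FixedBasis.
Variables (v : I -> V) (A : {set I}) (T : {vspace V}).
Hypothesis bA : is_vbasis v T A.

Let fA : vfree v A. Proof. by case/is_vbasisP: bA. Qed.

Lemma vec_reach C b :
  b \in C -> v b \in T -> v b = \sum_(a in reach v A C) vcoef v A (v b) a *: v a.
Proof.
move=> bC bT; rewrite [LHS](@vspan_vcoef _ _ _ v A) ?(is_vbasisP bA) //.
rewrite (bigID (mem (reach v A C))) /= [X in _ + X]big1 ?addr0.
  apply: eq_bigl => a; case: (boolP (a \in reach v A C)); rewrite ?andbF //.
  by move/(subsetP (reach_sub v A C))->.
move=> a /andP[aA]; rewrite inE aA /= negb_exists_in => /forall_inP/(_ b bC).
by rewrite negbK => /eqP->; rewrite scale0r.
Qed.

Variable C : {set I}.
Hypotheses (CA : [disjoint A & C]) (CT : forall b, b \in C -> v b \in T).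

Lemma is_vbasis_flat : is_vbasis v (vspan v (flat v A C)) (reach v A C).
Proof.
rewrite /is_vbasis (vfreeS (reach_sub v A C)) //= eqEsubv vspanS ?subsetUr //=.
apply: vspan_sub => i; rewrite inE => /orP[iC|]; last exact: memv_vspan.
by apply/vspanP; exists (vcoef v A (v i)); apply: vec_reach => //; apply: CT.
Qed.

Lemma notin_reach b : b \in C -> b \notin reach v A C.
Proof.
move=> bC; apply: contraL CA => /(subsetP (reach_sub v A C)) bA'.
by apply/pred0Pn; exists b; rewrite /= bA'.
Qed.

Lemma card_flat : #|flat v A C| = (\dim (vspan v (flat v A C)) + #|C|)%N.
Proof.
rewrite -(is_vbasis_card is_vbasis_flat) cardsU disjoint_setI0 ?cards0 ?subn0 1?addnC //.
by rewrite disjoint_subset; apply/subsetP => b; apply: notin_reach.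
Qed.

Lemma flat_noncoloop x :
  x \in flat v A C -> v x \in vspan v (flat v A C :\ x).
Proof.
have bF := is_vbasis_flat; have [_ sF] := is_vbasisP bF.
have [xC _|xC] := boolP (x \in C).
  have : v x \in vspan v (flat v A C) by apply: memv_vspan; rewrite inE xC.
  rewrite -{1}sF; apply/subvP/vspanS.
  by rewrite subsetD1 subsetUr notin_reach.
rewrite inE (negPf xC) /= => xr; move: (xr); rewrite inE => /andP[xA].
case/exists_inP => b bC cb.
have br := notin_reach bC.
have bs : v b \in vspan v (flat v A C) by apply: memv_vspan; rewrite inE bC.
have /is_vbasisP[_ E] : is_vbasis v (vspan v (flat v A C)) (b |: (reach v A C :\ x)).
  apply: is_vbasis_exchange => //.
  by rewrite (vcoef_sub (A := A)) ?reach_sub ?sF.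
have : v x \in vspan v (flat v A C) by apply: memv_vspan; rewrite inE xr orbT.
rewrite -{1}E; apply/subvP/vspanS; apply/subsetP => i; rewrite !inE.
case/orP => [/eqP->|/andP[-> ->]]; last by rewrite orbT.
by rewrite bC andbT; apply: contraNneq xC => <-.
Qed.

Variable b : I.
Hypotheses (bC : b \notin C) (bnA : b \notin A) (bT : v b \in T).

Lemma wvecE :
  wvec v A C b =
  v b - \sum_(a in reach v A (b |: C) :\: reach v A C) vcoef v A (v b) a *: v a.
Proof.
have bE := vec_reach (setU11 b C) bT.
rewrite [X in X - _]bE (bigID (mem (reach v A C))) /=.
rewrite [X in _ + X - _](eq_bigl (fun i => i \in reach v A (b |: C) :\: reach v A C)); last first.
  by move=> i; rewrite in_setD andbC.
rewrite addrK; apply: eq_bigl => a.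
case: (boolP (a \in reach v A C)) => [|_]; last by rewrite andbF.
by move/(subsetP (reachS _ _ (subsetUr _ _)))->.
Qed.

Lemma wvec_span_flat : wvec v A C b \in vspan v (flat v A C).
Proof.
by apply: rpred_sum => a ar; apply: memvZ; apply: memv_vspan; rewrite inE ar orbT.
Qed.

Lemma flat_diffE :
  flat v A (b |: C) :\: flat v A C = b |: (reach v A (b |: C) :\: reach v A C).
Proof.
have bnr D : b \notin reach v A D by apply: contra bnA; apply/subsetP/reach_sub.
apply/setP => i; rewrite /flat !in_setD !in_setU !in_setD !in_set1.
have [->|ib] := eqVneq i b; first by rewrite (negPf bC) bnr.
have [iC|iC] := boolP (i \in C); last by rewrite orbF.
have : i \notin reach v A (b |: C).
  by apply: contraL CA => /(subsetP (reach_sub _ _ _)) iA; apply/pred0Pn; exists i; rewrite /= iA.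
by move=> /negbTE->; rewrite andbF.
Qed.

Lemma wvec_span_diff :
  wvec v A C b \in vspan v (flat v A (b |: C) :\: flat v A C).
Proof.
rewrite flat_diffE wvecE; apply: memvB; first by apply: memv_vspan; rewrite setU11.
by apply: rpred_sum => a ar; apply: memvZ; apply: memv_vspan; rewrite in_setU ar orbT.
Qed.

End FixedBasis.
End Flats.

(** * Products along chains of flats *)

Section Chains.
Variables (k : fieldType) (V : vectType k) (N : nat).
Local Notation I := 'I_N.
Local Notation R := {mpoly k[\dim {:V}]}.
Local Notation lf := (@linear_form k V).
Implicit Types (v : I -> V) (A B C J Z : {set I}) (T : {vspace V}) (f : R).

(** For [J] nonempty this space turns out to be the multiplicity space.  Being defined
    without chains of flats, it is easily compared with its analogues for the
    deletion and the contraction. *)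
Definition internal v J f : Prop :=
  forall x, x \in J -> cobasis_span v (vspan v J) (J :\ x) f.

Lemma cobasis_span_gen v T A Z :
  Z \subset A -> is_vbasis v T Z -> cobasis_span v T A (vprod v (A :\: Z)).
Proof.
move=> ZA bZ; apply: (@inspan_gen _ _ _
  [pred Z : {set I} | (Z \subset A) && is_vbasis v T Z] (fun Z => vprod v (A :\: Z)) Z).
by rewrite /= ZA.
Qed.

Lemma vprod0 v : vprod v set0 = 1.
Proof. by rewrite /vprod big_set0. Qed.

Lemma internal_circuit v J :
  (forall x, x \in J -> v x \in vspan v (J :\ x)) ->
  #|J| = (\dim (vspan v J)).+1 -> internal v J 1.
Proof.
move=> Jx cJ x xJ; rewrite -(vprod0 v) -(setDv (J :\ x)); apply: cobasis_span_gen => //.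
apply: is_vbasis_spanE; last by rewrite (cardsD1 x) xJ add1n in cJ; have [->] := cJ.
apply: vspan_sub => i iJ; have [->|ix] := eqVneq i x; first exact: Jx.
by apply: memv_vspan; rewrite !inE ix.
Qed.

(** To avoid an element [x] of [J], expand the new factor [w] over [J' :\: J]; to
    avoid [x] in [J' :\: J], expand [w] over [J], the term of [y] being multiplied
    by the expansion of [f] that avoids [y]. *)
Lemma internal_step v J J' f w :
  J \subset J' ->
  (\dim (vspan v J') + #|J|).+1 = (\dim (vspan v J) + #|J'|)%N ->
  (forall x, x \in J' :\: J -> v x \in vspan v (J' :\ x)) ->
  w \in vspan v (J' :\: J) -> w \in vspan v J ->
  internal v J f -> internal v J' (f * lf w).
Proof.
move=> JJ' dimJ ncl wD wJ If.
have sub i : i \in J -> i \in J' by apply/subsetP.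
have bas Z x : Z \subset J -> is_vbasis v (vspan v J) Z -> x \in J' :\: J ->
    is_vbasis v (vspan v J') (Z :|: ((J' :\: J) :\ x)).
  move=> ZJ bZ xD; apply: is_vbasis_spanE.
    have /is_vbasisP[_ sZ] := bZ; rewrite vspan_setU sZ -vspan_setU.
    apply: (@subv_trans _ _ (vspan v (J' :\ x))); last first.
      apply: vspanS; apply/subsetP => i; rewrite !inE => /andP[-> ->].
      by rewrite andbT orbN.
    apply: vspan_sub => i iJ; have [->|ix] := eqVneq i x; first exact: ncl.
    by apply: memv_vspan; rewrite !inE ix.
  apply: leq_trans (leq_card_setU _ _) _.
  rewrite (is_vbasis_card bZ) -ltnS -addnS.
  have -> : (#|(J' :\: J) :\ x|.+1 = #|J' :\: J|)%N.
    by rewrite [RHS](cardsD1 x) xD.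
  rewrite -(leq_add2r #|J|) -addnA.
  have -> : (#|J' :\: J| + #|J| = #|J'|)%N.
    by rewrite -(cardsID J J') addnC (setIidPr JJ').
  by rewrite -dimJ addSn.
move=> x xJ'; have [xJ|xJ] := boolP (x \in J).
  have /vspanP[c ->] := wD.
  rewrite linear_sum mulr_sumr; apply: inspan_sum => j jD.
  rewrite linearZ /= -scalerAr; apply: inspanZ.
  rewrite mulrC; apply: inspan_mull (If x xJ) => Z /andP[ZA bZ].
  have ZJ : Z \subset J by apply: subset_trans ZA (subsetDl _ _).
  have -> : lf (v j) * vprod v ((J :\ x) :\: Z) =
      vprod v ((J' :\ x) :\: (Z :|: ((J' :\: J) :\ j))).
    rewrite [RHS](@vprod_setD1 _ _ _ _ _ j).
      congr (_ * vprod _ _); apply/setP => i; rewrite !inE.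
      have [->|ij] /= := eqVneq i j.
        by move: jD; rewrite inE => /andP[/negPf->]; rewrite !andbF.
      case: (boolP (i \in J)) => [iJ|iJ]; first by rewrite sub //= orbF.
      by case: (i \in J'); rewrite ?andbF ?orbT.
    rewrite !inE eqxx /= orbF; move: jD; rewrite inE => /andP[jJ ->].
    rewrite andbT; apply/andP; split; first by apply: contra jJ; apply/subsetP.
    by apply: contraNneq jJ => ->.
  apply: cobasis_span_gen; last exact: bas.
  apply/subsetP => i; rewrite !inE => /orP[iZ|/and3P[_ iJ ->]].
    by have := subsetP ZA i iZ; rewrite !inE => /andP[-> /sub->].
  by rewrite andbT; apply: contraNneq iJ => ->.
have xD : x \in J' :\: J by rewrite inE xJ.
have /vspanP[c ->] := wJ.
rewrite linear_sum mulr_sumr; apply: inspan_sum => y yJ.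
rewrite linearZ /= -scalerAr; apply: inspanZ.
rewrite mulrC; apply: inspan_mull (If y yJ) => Z /andP[ZA bZ].
have ZJ : Z \subset J by apply: subset_trans ZA (subsetDl _ _).
have -> : lf (v y) * vprod v ((J :\ y) :\: Z) =
    vprod v ((J' :\ x) :\: (Z :|: ((J' :\: J) :\ x))).
  have -> : (J' :\ x) :\: (Z :|: ((J' :\: J) :\ x)) = J :\: Z.
    apply/setP => i; rewrite !inE.
    have [->|ix] /= := eqVneq i x; first by rewrite (negPf xJ) !andbF.
    case: (boolP (i \in J)) => [iJ|iJ]; first by rewrite sub //= orbF andbT.
    by case: (i \in J'); rewrite ?andbF ?orbT.
  rewrite [RHS](@vprod_setD1 _ _ _ _ _ y).
    by congr (_ * vprod _ _); apply/setP => i; rewrite !inE andbCA.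
  rewrite inE yJ andbT; apply/negP => /(subsetP ZA).
  by rewrite !inE eqxx.
apply: cobasis_span_gen; last exact: bas.
apply/subsetP => i; rewrite !inE => /orP[/(subsetP ZJ) iJ|/and3P[-> _ ->] //].
by rewrite sub // andbT; apply: contraNneq xJ => <-.
Qed.

End Chains.

(** * The beta-nbc family and its recursion *)

Section BetaFamily.
Variables (k : fieldType) (V : vectType k) (n : nat).
Local Notation I := 'I_n.+1.
Local Notation R := {mpoly k[\dim {:V}]}.
Local Notation lf := (@linear_form k V).
Implicit Types (v : I -> V) (A B C J Z : {set I}) (T : {vspace V}) (f : R).

(** The beta-nbc condition on [B], in terms of the complementary basis [A] of the
    configuration: in the bipartite graph joining [a] and [b] when [a] may be
    replaced by [b] in [A], every vertex other than [ord0] has a smaller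
    neighbour. *)
Definition beta_pair v A B : bool :=
  [&& is_vbasis v (vspan v (A :|: B)) A,
      [forall a in A, [exists b in B, (b < a)%N && (vcoef v A (v b) a != 0)]] &
      [forall b in B, (b != ord0) ==>
         [exists a in A, (a < b)%N && (vcoef v A (v b) a != 0)]]].

Definition beta_prod v A B : R :=
  \prod_(b in B | b != ord0) lf (wvec v A [set b' in B | (b' < b)%N] b).

Definition below (t : nat) : {set I} := [set i : I | (i < t)%N].

Lemma setUD_sub Z J : Z \subset J -> Z :|: (J :\: Z) = J.
Proof. by move=> ZJ; rewrite -{1}(setIidPr ZJ) setID. Qed.

Lemma disjoint_setD Z J : [disjoint Z & J :\: Z].
Proof. by rewrite disjoint_sym disjoints_subset setDE subsetIr. Qed.

Lemma below_set1 (q : I) t : q = t :> nat -> below t.+1 = q |: below t.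
Proof.
move=> qt; apply/setP => i; rewrite !inE ltnS leq_eqVlt -qt.
by congr (_ || _).
Qed.

Lemma beta_pair_ord0 v A B : beta_pair v A B -> ord0 \notin A.
Proof.
case/and3P => _ /forall_inP H _; apply/negP => /H /exists_inP[b _].
by rewrite ltn0.
Qed.

Lemma beta_pair_reach v A B : beta_pair v A B -> reach v A B = A.
Proof.
case/and3P => _ /forall_inP H _; apply/eqP; rewrite eqEsubset reach_sub.
apply/subsetP => a aA; rewrite inE aA /=.
by have /exists_inP[b bB /andP[_ cb]] := H a aA; apply/exists_inP; exists b.
Qed.

(** Every element of [A] lies on the fundamental circuit of some element of [B]. *)
Lemma beta_pair_noncoloop v A B x :
  [disjoint A & B] -> beta_pair v A B -> x \in A :|: B ->
  v x \in vspan v ((A :|: B) :\ x).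
Proof.
move=> dAB nAB xAB; have /and3P[bA _ _] := nAB.
have := @flat_noncoloop _ _ _ v A _ bA B dAB _ x.
rewrite /flat beta_pair_reach // [B :|: A]setUC; apply=> // b bB.
by apply: memv_vspan; rewrite inE bB orbT.
Qed.

Lemma beta_pair_nonloop v A B q :
  beta_pair v A B -> q \in A :|: B -> q != ord0 -> v q != 0.
Proof.
case/and3P => /is_vbasisP[fA _] _ /forall_inP H; rewrite inE => /orP[qA _|qB q0].
  apply/eqP => v0; move: fA; rewrite -(setD1K qA) => /(vfreeU1_notin _).
  by rewrite !inE eqxx v0 mem0v => /(_ isT).
have /implyP/(_ q0)/exists_inP[a _ /andP[_]] := H q qB.
by apply: contraNneq => ->; rewrite vcoef0.
Qed.

Section Recursion.
Variables (v : I -> V) (q : I) (A B : {set I}).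
Hypotheses (qmax : forall i, i \in A :|: B -> (i < q)%N) (q0 : v q != 0)
  (qs : v q \in vspan v (A :|: B)).

Let qA : q \notin A.
Proof. by apply/negP => H; have := qmax (i := q); rewrite inE H ltnn => /(_ isT). Qed.
Let qB : q \notin B.
Proof. by apply/negP => H; have := qmax (i := q); rewrite inE H orbT ltnn => /(_ isT). Qed.
Let Amax a : a \in A -> (a < q)%N.
Proof. by move=> aA; apply: qmax; rewrite inE aA. Qed.
Let Bmax b : b \in B -> (b < q)%N.
Proof. by move=> bB; apply: qmax; rewrite inE bB orbT. Qed.

Lemma beta_pair_delete : beta_pair v A (q |: B) = beta_pair v A B.
Proof.
rewrite /beta_pair.
have -> : vspan v (A :|: (q |: B)) = vspan v (A :|: B).
  by rewrite setUCA vspanU1_dep.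
have [bA|//] := boolP (is_vbasis v _ A); rewrite /=; congr (_ && _).
  apply: eq_forallb_in => a aA; apply/exists_inP/exists_inP => -[b].
    rewrite in_setU1 => /orP[/eqP->|bB] H; last by exists b.
    by have := Amax aA; rewrite ltnNge ltnW //; case/andP: H.
  by move=> bB H; exists b => //; rewrite in_setU1 bB orbT.
apply/forall_inP/forall_inP => H b bB; first by apply: H; rewrite in_setU1 bB orbT.
move: bB; rewrite in_setU1 => /orP[/eqP->|]; last exact: H.
apply/implyP => _; apply: contraR q0 => /exists_inPn H'.
rewrite (@vspan_vcoef _ _ _ v A (v q)) ?(is_vbasisP bA) // big1 // => a aA.
by have := H' a aA; rewrite Amax // negbK => /eqP->; rewrite scale0r.
Qed.

(** The factor of [q] is [v q] itself, since every element of [A] is joined to an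
    element of [B] smaller than [q]. *)
Lemma beta_prod_delete :
  q != ord0 -> beta_pair v A B -> beta_prod v A (q |: B) = lf (v q) * beta_prod v A B.
Proof.
move=> qn0 nAB; have /and3P[bA _ _] := nAB.
rewrite /beta_prod big_mkcondr big_setU1 //= qn0 -big_mkcondr /=; congr (_ * _).
  have -> : [set b' in q |: B | (b' < q)%N] = B.
    apply/setP => b; rewrite !inE; have [->|] := eqVneq b q.
      by rewrite ltnn andbF (negPf qB).
    by case: (boolP (b \in B)) => // /Bmax->.
  by rewrite /wvec beta_pair_reach // -vspan_vcoef // (is_vbasisP bA).
apply: eq_bigr => b /andP[bB _]; congr (lf (wvec _ _ _ _)).
apply/setP => b'; rewrite !inE; have [->|//] := eqVneq b' q.
by rewrite (negPf qB) ltnNge ltnW ?Bmax.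
Qed.

Let spanq : vspan v ((q |: A) :|: B) = vspan v (A :|: B).
Proof. by rewrite -setUA vspanU1_dep. Qed.

Let spanc : vspan (contrv v q) (A :|: B) = (contr (v q) @: vspan v (q |: A :|: B))%VS.
Proof. by rewrite spanq vspan_contr. Qed.

Let vcoefc a x : is_vbasis v (vspan v (q |: A :|: B)) (q |: A) -> a \in A ->
  x \in vspan v (q |: A :|: B) ->
  vcoef (contrv v q) A (contr (v q) x) a = vcoef v (q |: A) x a.
Proof.
by case/is_vbasisP => fA sA aA xs; rewrite vcoef_contr // sA.
Qed.

Let Bspan b : b \in B -> v b \in vspan v (q |: A :|: B).
Proof. by move=> bB; apply: memv_vspan; rewrite inE bB orbT. Qed.

Lemma beta_pair_contract : beta_pair v (q |: A) B = beta_pair (contrv v q) A B.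
Proof.
rewrite /beta_pair spanc is_vbasis_contr //; last by rewrite spanq.
have [bA|//] := boolP (is_vbasis v _ (q |: A)); have [fA _] := is_vbasisP bA.
rewrite /=; congr (_ && _); last first.
  apply: eq_forallb_in => b bB; congr (_ ==> _).
  apply/exists_inP/exists_inP => -[a aA /andP[ab ca]]; last first.
    by exists a; rewrite ?in_setU1 ?aA ?orbT // ab -vcoefc ?Bspan.
  move: aA; rewrite in_setU1 => /orP[/eqP E|aA].
    by move: ab; rewrite E ltnNge ltnW ?Bmax.
  by exists a => //; rewrite ab vcoefc ?Bspan.
apply/forall_inP/forall_inP => H a aA.
  have aqA : a \in q |: A by rewrite in_setU1 aA orbT.
  have /exists_inP[b bB /andP[ba cb]] := H a aqA.
  by apply/exists_inP; exists b => //; rewrite ba vcoefc ?Bspan.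
move: aA; rewrite in_setU1 => /orP[/eqP->|aA]; last first.
  have /exists_inP[b bB /andP[ba cb]] := H a aA.
  by apply/exists_inP; exists b => //; rewrite ba -vcoefc ?Bspan.
(* Otherwise all the other vectors lie in the hyperplane where the coordinate of
   [q] vanishes, although [v q] is in their span. *)
apply: contraT => /exists_inPn Hq.
have := vcoef_in fA (setU11 q A) (setU11 q A); rewrite eqxx.
rewrite (vcoef_span0 (Z := A :|: B)) // => [/eqP|i].
  by rewrite eq_sym oner_eq0.
rewrite in_setU => /orP[iA|iB].
  rewrite vcoef_in ?setU11 ?in_setU1 ?iA ?orbT //.
  by case: eqP qA => // ->; rewrite iA.
by have := Hq i iB; rewrite Bmax // negbK => /eqP.
Qed.

Lemma beta_prod_contract :
  beta_pair v (q |: A) B -> pcontr (v q) (beta_prod v (q |: A) B) = beta_prod (contrv v q) A B.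
Proof.
case/and3P => bA _ _; rewrite rmorph_prod; apply: eq_bigr => b /andP[bB _].
rewrite /= pcontr_lf; congr lf; rewrite /wvec linear_sum /=.
set C := [set b' in B | _].
have CB b' : b' \in C -> b' \in B by rewrite inE => /andP[].
rewrite (bigID (pred1 q)) /= big1 ?add0r; last first.
  by move=> a /andP[_ /eqP->]; rewrite linearZ /= contr_id scaler0.
apply: eq_big => [a|a /andP[]].
  rewrite !inE; have [->|aq] /= := eqVneq a q; first by rewrite (negPf qA) andbF.
  rewrite andbT; have [aA|//] := boolP (a \in A).
  apply/exists_inP/exists_inP => -[b' b'C cb]; exists b' => //.
    by rewrite vcoefc ?Bspan // CB.
  by rewrite -vcoefc ?Bspan // CB.
rewrite inE in_setU1 => /andP[/orP[->//|aA] _] _.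
by rewrite linearZ /= vcoefc ?Bspan.
Qed.

End Recursion.

Definition beta_below t v Z : bool :=
  (Z \subset below t) && beta_pair v Z (below t :\: Z).

Definition beta_prod_below t v Z : R := beta_prod v Z (below t :\: Z).

Section RecursionBelow.
Variables (v : I -> V) (q : I) (t : nat).
Hypotheses (qt : q = t.+1 :> nat) (q0 : v q != 0)
  (qs : v q \in vspan v (below t.+1)).

Let qn0 : q != ord0. Proof. by rewrite -(inj_eq val_inj) /= qt. Qed.
Let qbelow : q \notin below t.+1. Proof. by rewrite inE qt ltnn. Qed.

Let subq Z : q \notin Z -> (Z \subset below t.+2) = (Z \subset below t.+1).
Proof.
move=> qZ; rewrite (below_set1 qt); apply/idP/idP => [|H]; last first.
  exact: subset_trans H (subsetUr _ _).
move=> H; apply/subsetP => i iZ; have := subsetP H i iZ; rewrite in_setU1.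
by case/orP => // /eqP E; rewrite -E iZ in qZ.
Qed.

Let cover Z : Z \subset below t.+1 -> Z :|: (below t.+1 :\: Z) = below t.+1.
Proof. exact: setUD_sub. Qed.

Let qmax Z : Z \subset below t.+1 ->
  forall i, i \in Z :|: (below t.+1 :\: Z) -> (i < q)%N.
Proof. by move=> /cover-> i; rewrite inE qt. Qed.

Let qs' Z : Z \subset below t.+1 -> v q \in vspan v (Z :|: (below t.+1 :\: Z)).
Proof. by move=> /cover->. Qed.

Lemma beta_below_delete Z : q \notin Z ->
  beta_below t.+2 v Z = beta_below t.+1 v Z.
Proof.
move=> qZ; rewrite /beta_below subq //; have [ZJ|//] := boolP (Z \subset _).
have -> : below t.+2 :\: Z = q |: (below t.+1 :\: Z).
  rewrite (below_set1 qt) setDUl; congr (_ :|: _).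
  by apply/setDidPl; rewrite disjoints1.
by rewrite /= beta_pair_delete ?qs' //; apply: qmax.
Qed.

Lemma beta_prod_below_delete Z : q \notin Z -> beta_below t.+1 v Z ->
  beta_prod_below t.+2 v Z = lf (v q) * beta_prod_below t.+1 v Z.
Proof.
move=> qZ /andP[ZJ nZ]; rewrite /beta_prod_below.
have -> : below t.+2 :\: Z = q |: (below t.+1 :\: Z).
  rewrite (below_set1 qt) setDUl; congr (_ :|: _).
  by apply/setDidPl; rewrite disjoints1.
by rewrite beta_prod_delete ?qs' //; apply: qmax.
Qed.

Let diffq Z : q \notin Z -> below t.+2 :\: (q |: Z) = below t.+1 :\: Z.
Proof.
move=> qZ; rewrite (below_set1 qt); apply/setP => i; rewrite !in_setD !in_setU1.
by have [->|] := eqVneq i q; rewrite //= (negPf qbelow) andbF.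
Qed.

Lemma beta_below_contract Z : q \notin Z ->
  beta_below t.+2 v (q |: Z) = beta_below t.+1 (contrv v q) Z.
Proof.
move=> qZ; rewrite /beta_below diffq //.
have -> : (q |: Z \subset below t.+2) = (Z \subset below t.+1).
  by rewrite subUset sub1set inE qt ltnSn subq.
have [ZJ|//] := boolP (Z \subset _).
by rewrite /= beta_pair_contract ?qs' //; apply: qmax.
Qed.

Lemma beta_prod_below_contract Z : q \notin Z -> beta_below t.+2 v (q |: Z) ->
  pcontr (v q) (beta_prod_below t.+2 v (q |: Z)) = beta_prod_below t.+1 (contrv v q) Z.
Proof.
move=> qZ nZ; have ZJ : Z \subset below t.+1.
  by move: nZ; rewrite beta_below_contract // => /andP[].
move: nZ; rewrite /beta_prod_below /beta_below diffq // => /andP[_ nZ].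
by rewrite beta_prod_contract ?qs' //; apply: qmax.
Qed.

End RecursionBelow.

Lemma beta_below_loop t v (q : I) Z :
  q = t.+1 :> nat -> v q = 0 -> ~~ beta_below t.+2 v Z.
Proof.
move=> qt v0; apply/negP => /andP[ZJ nZ].
have := beta_pair_nonloop (q := q) nZ; rewrite v0 eqxx (setUD_sub ZJ).
by rewrite inE qt ltnSn -(inj_eq val_inj) /= qt => /(_ isT isT).
Qed.

Lemma beta_below_coloop t v (q : I) Z :
  q = t.+1 :> nat -> v q \notin vspan v (below t.+1) -> ~~ beta_below t.+2 v Z.
Proof.
move=> qt; apply: contra => /andP[ZJ nZ].
have := beta_pair_noncoloop (x := q) _ nZ; rewrite (setUD_sub ZJ).
rewrite disjoint_setD inE qt ltnSn => /(_ isT isT).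
apply/subvP/vspanS; rewrite (below_set1 qt) setU1K //.
by rewrite inE qt ltnn.
Qed.

(** * Linear independence *)

(** Removing the last element is a deletion and a contraction, unless it is a loop
    or a coloop; then, as soon as there is another element, the beta-nbc family is
    empty. *)
Lemma beta_below_lin_indep t v : (t < n.+1)%N ->
  lin_indep (beta_below t.+1 v) (beta_prod_below t.+1 v).
Proof.
elim: t v => [|t IH] v tn.
  have Z0 Z : beta_below 1 v Z -> Z = set0.
    case/andP => ZJ /beta_pair_ord0 Z0; apply/eqP; rewrite -subset0.
    apply/subsetP => i iZ; have := subsetP ZJ i iZ; rewrite inE ltnS leqn0 => i0.
    by move: iZ; rewrite (_ : i = ord0) ?(negPf Z0) //; apply/val_inj/eqP.
  move=> c E Z PZ; have ZE := Z0 Z PZ; rewrite ZE in PZ *; move: E.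
  rewrite (bigD1 set0) //= big1 ?addr0; last first.
    by move=> Z' /andP[/Z0->]; rewrite eqxx.
  rewrite /beta_prod_below /beta_prod big1 => [/eqP|b /andP[]].
    by rewrite scaler_eq0 oner_eq0 orbF => /eqP.
  by rewrite setD0 inE ltnS leqn0 => b0; rewrite -(inj_eq val_inj) /= b0.
pose q : I := Ordinal tn.
have qt : q = t.+1 :> nat by [].
have [v0|q0] := eqVneq (v q) 0.
  by move=> c _ Z; rewrite (negPf (beta_below_loop Z qt v0)).
have [qs|qs] := boolP (v q \in vspan v (below t.+1)); last first.
  by move=> c _ Z; rewrite (negPf (beta_below_coloop Z qt qs)).
apply: (lin_indep_del_contr (q := q) q0); last 2 first.
- exact: (IH v (ltnW tn)).
- exact: (IH (contrv v q) (ltnW tn)).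
- move=> Z qZ; rewrite (beta_below_delete qt q0 qs) // => nZ.
  by rewrite (beta_prod_below_delete qt qs).
move=> Z qZ nZ; rewrite -(beta_below_contract qt q0 qs) //.
by rewrite (beta_prod_below_contract qt q0 qs).
Qed.

(** * Spanning *)

(** The flats of the initial segments of [B] form a chain that starts from a
    circuit, to which [internal_step] applies with the factors of [beta_prod]. *)
Lemma beta_prod_internal v A B :
  [disjoint A & B] -> ord0 \in B -> beta_pair v A B -> internal v (A :|: B) (beta_prod v A B).
Proof.
move=> dAB B0 nAB; have /and3P[bA _ _] := nAB.
have BT b : b \in B -> v b \in vspan v (A :|: B).
  by move=> bB; apply: memv_vspan; rewrite inE bB orbT.
pose C t := [set b in B | (b < t)%N].
have CB t : C t \subset B by apply/subsetP => b; rewrite inE => /andP[].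
have dC t : [disjoint A & C t].
  by rewrite disjoint_sym (disjointWl (CB t)) // disjoint_sym.
have CT t b : b \in C t -> v b \in vspan v (A :|: B) by move=> /(subsetP (CB t))/BT.
have main t : internal v (flat v A (C t.+1))
    (\prod_(b in C t.+1 | b != ord0) lf (wvec v A (C b) b)).
  elim: t => [|t IH].
    have C1 : C 1%N = [set ord0].
      apply/setP => b; rewrite !inE ltnS leqn0 -(inj_eq val_inj) /=.
      have [b0|] := eqVneq (b : nat) 0%N; last by rewrite andbF.
      by rewrite andbT (_ : b = ord0) ?B0 //; apply: val_inj.
    rewrite big1 => [|b /andP[]]; last by rewrite C1 inE => ->.
    apply: internal_circuit; first exact: (flat_noncoloop bA (dC 1%N) (@CT 1%N)).
    by rewrite (card_flat bA) // ?C1 ?cards1 ?addn1 // -C1; apply: CT.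
  have [tn|tn] := ltnP t.+1 n.+1; last first.
    have -> : C t.+2 = C t.+1 => //.
    apply/setP => b; rewrite !inE !(leq_trans (ltn_ord b)) //.
    exact: leq_trans tn _.
  pose q : I := Ordinal tn.
  have CS : C t.+2 = (if q \in B then q |: C t.+1 else C t.+1).
    apply/setP => b; rewrite !inE ltnS leq_eqVlt -[t.+1]/(val q) (inj_eq val_inj).
    by case: ifP => qB; rewrite ?inE; have [->|//] := eqVneq b q; rewrite qB.
  rewrite CS; case: ifP => // qB.
  have qC : q \notin C t.+1 by rewrite inE ltnn andbF.
  have qA : q \notin A by rewrite (disjointFl dAB qB).
  rewrite big_mkcondr big_setU1 //= -big_mkcondr /= mulrC -[C t.+1]/(C q).
  have CS' : C t.+2 = q |: C q by rewrite CS qB.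
  have qT := BT q qB.
  apply: (@internal_step _ _ _ _ (flat v A (C q))) IH.
  - by apply: flatS; apply: subsetUr.
  - rewrite -CS' !(card_flat bA); try by [apply: dC|apply: CT].
    by rewrite CS' cardsU1 qC add1n !addnS addnCA.
  - move=> x; rewrite inE -CS' => /andP[_ xF].
    exact: (flat_noncoloop bA (dC _) (@CT _)) xF.
  - by apply: (wvec_span_diff bA) => //; apply: dC.
  exact: wvec_span_flat.
have CN : C n.+1 = B by apply/setP => b; rewrite inE ltn_ord andbT.
by have := main n; rewrite CN /flat beta_pair_reach // setUC.
Qed.

Lemma beta_prod_below_internal t v Z :
  beta_below t.+1 v Z -> internal v (below t.+1) (beta_prod_below t.+1 v Z).
Proof.
case/andP => ZJ nZ; have := beta_prod_internal (disjoint_setD _ _) _ nZ.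
rewrite (setUD_sub ZJ); apply.
by rewrite !inE andbT; apply: beta_pair_ord0 nZ.
Qed.

(** A loop or a coloop, when it is not alone, forces the internal space to vanish;
    otherwise the deletion-contraction sequence gives the induction. *)
Lemma internal_span t v f : (t < n.+1)%N -> internal v (below t.+1) f ->
  inspan (beta_below t.+1 v) (beta_prod_below t.+1 v) f.
Proof.
elim: t v f => [|t IH] v f tn If.
  have b1 : below 1 = [set ord0].
    by apply/setP => i; rewrite !inE ltnS leqn0 -(inj_eq val_inj).
  have [|c ->] := If ord0; first by rewrite inE.
  apply: inspan_sum => Z /=; rewrite b1 setDv subset0 => /andP[/eqP-> bZ].
  apply: inspanZ; rewrite set0D vprod0.
  have -> : 1 = beta_prod_below 1 v set0.
    rewrite /beta_prod_below /beta_prod big1 // => b /andP[]; rewrite setD0 b1 inE => ->.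
    by [].
  apply: inspan_gen; rewrite /beta_below sub0set /beta_pair setD0 set0U b1 bZ /=.
  apply/andP; split; first by apply/forall_inP => a; rewrite inE.
  by apply/forall_inP => b; rewrite inE => ->.
pose q : I := Ordinal tn.
have qt : q = t.+1 :> nat by [].
set J' := below t.+1; have JE : below t.+2 = q |: J' by apply: below_set1.
have qJ' : q \notin J' by rewrite inE ltnn.
have ord0J : ord0 \in J' by rewrite inE.
rewrite JE in If.
have qn0 : q != ord0 by rewrite -(inj_eq val_inj).
have [v0|q0] := eqVneq (v q) 0.
  have [|c ->] := If ord0; first by rewrite in_setU1 ord0J orbT.
  apply: inspan_sum => Z /andP[ZA /is_vbasisP[fZ _]].
  have qZ : q \notin Z.
    apply/negP => qZ; move: fZ; rewrite -(setD1K qZ) => /(vfreeU1_notin _).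
    by rewrite !inE eqxx v0 mem0v => /(_ isT).
  rewrite (@vprod_setD1 _ _ _ _ _ q) ?v0 ?linear0 ?mul0r ?scaler0; first exact: inspan0.
  by rewrite !inE eqxx qZ qn0.
have [qs|qs] := boolP (v q \in vspan v J'); last first.
  have [|c ->] := If q; first by rewrite setU11.
  apply: inspan_sum => Z /andP[ZA /is_vbasisP[_ sZ]].
  case/negP: qs; rewrite setU1K // in ZA.
  apply: (subvP (vspanS v ZA)); rewrite sZ; apply: memv_vspan; exact: setU11.
have sJ : vspan v (q |: J') = vspan v J' by apply: vspanU1_dep.
have qmax x i : i \in (q |: J') :\ x -> (i <= q)%N.
  rewrite in_setD1 in_setU1 => /andP[_ /orP[/eqP->//|]].
  by rewrite inE; apply: ltnW.
(* Products over complements of bases avoiding [q] contain the factor [v q], and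
   the others map to such products for the contraction. *)
have Ic : internal (contrv v q) J' (pcontr (v q) f).
  move=> x xJ'; have xJ : x \in q |: J' by rewrite in_setU1 xJ' orbT.
  have xq : x != q by apply: contraTneq xJ' => ->.
  apply: (inspan_linear (F := pcontr (v q)) _ (If x xJ)) => Z /= /andP[ZA bZ].
  have [qZ|qZ] := boolP (q \in Z); last first.
    rewrite (@vprod_setD1 _ _ _ _ _ q) ?rmorphM /= ?pcontr_self ?mul0r.
      exact: inspan0.
    by rewrite !inE eqxx qZ eq_sym xq.
  rewrite vprod_contr; have -> : (q |: J') :\ x :\: Z = J' :\ x :\: (Z :\ q).
    apply/setP => i; rewrite !inE; have [->|] := eqVneq i q => //=.
    by rewrite qZ ltnn !andbF.
  apply: cobasis_span_gen.
    apply/subsetP => i; rewrite in_setD1 => /andP[iq iZ].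
    by have := subsetP ZA i iZ; rewrite !inE (negPf iq).
  rewrite vspan_contr -sJ is_vbasis_contr ?setD1K ?setD11 //.
  by apply: memv_vspan; exact: setU11.
have [c cE] := IH _ _ (ltnW tn) Ic.
pose S := \sum_(Z | beta_below t.+1 (contrv v q) Z) c Z *: beta_prod_below t.+2 v (q |: Z).
have notq s w Z : (s < t.+2)%N -> beta_below s w Z -> q \notin Z.
  move=> st /andP[ZJ _]; apply/negP => /(subsetP ZJ); rewrite inE /= ltnNge.
  by rewrite -ltnS st.
have betaq Z : beta_below t.+1 (contrv v q) Z -> beta_below t.+2 v (q |: Z).
  by move=> nZ; rewrite (beta_below_contract qt) // (notq _ _ _ _ nZ).
have Sspan : inspan (beta_below t.+2 v) (beta_prod_below t.+2 v) S.
  by apply: inspan_sum => Z /betaq nZ; apply: inspanZ; apply: inspan_gen.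
have IS : internal v (q |: J') S.
  rewrite -JE => x xJ; apply: inspan_sum => Z /betaq nZ; apply: inspanZ.
  exact: beta_prod_below_internal nZ x xJ.
have Pf : pcontr (v q) (f - S) = 0.
  rewrite rmorphB /= cE; apply/eqP; rewrite subr_eq0; apply/eqP.
  rewrite [RHS]linear_sum; apply: eq_bigr => Z nZ.
  by rewrite linearZ /= (beta_prod_below_contract qt) ?betaq // (notq _ _ _ _ nZ).
(* The cofactor of [v q] obtained from the span attached to [x] does not depend on
   [x], because the polynomial ring is a domain. *)
have Hx x : x \in J' ->
    exists2 g, cobasis_span v (vspan v J') (J' :\ x) g & f - S = lf (v q) * g.
  move=> xJ'; have xJ : x \in q |: J' by rewrite in_setU1 xJ' orbT.
  have xq : q != x by apply: contraTneq xJ' => <-.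
  have If' : cobasis_span v (vspan v (q |: J')) ((q |: J') :\ x) (f - S).
    apply: inspanD; first exact: If.
    by rewrite -scaleN1r; apply: inspanZ; apply: IS.
  have [||g Hg ->] := cobasis_span_kernel (@qmax x) _ q0 _ If' Pf.
  - by move=> i; rewrite in_setD1 => /andP[_]; apply: memv_vspan.
  - by rewrite in_setD1 xq setU11.
  exists g => //; move: Hg; rewrite sJ.
  have -> // : (q |: J') :\ x :\ q = J' :\ x.
  apply/setP => i; rewrite !inE; have [->|//] := eqVneq i q.
  by rewrite ltnn andbF.
have [g _ gE] := Hx ord0 ord0J.
have Ig : internal v J' g.
  move=> x /Hx[g' Hg' E]; suff -> : g = g' by [].
  by apply: (mulfI (x := lf (v q))); rewrite ?linear_form_eq0 // -gE.
rewrite -[f](subrK S); apply: inspanD Sspan; rewrite gE.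
apply: inspan_mull (IH _ _ (ltnW tn) Ig) => Z nZ.
have qZ := notq _ _ _ (ltnSn _) nZ.
rewrite -(beta_prod_below_delete qt) //; apply: inspan_gen.
by rewrite (beta_below_delete qt).
Qed.

End BetaFamily.

(** * Matroid notions in coordinates *)

Section MatroidCoordinates.
Variables (k : fieldType) (V : vectType k) (I : finType) (v : I -> V).
Implicit Types (A B C X : {set I}).

Definition vmatroid : {set {set I}} := [set X | vfree v X].
Local Notation M := vmatroid.
Local Notation T := (vspan v [set: I]).

Lemma vspanT i : v i \in T. Proof. by apply: memv_vspan. Qed.

Lemma bases_vbasis A : (A \in bases M) = is_vbasis v T A.
Proof.
rewrite inE; apply/maxsetP/idP => [[]|bA].
  rewrite inE => fA Amax; apply: is_vbasis_spanE; last first.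
    move: fA; rewrite vfree_dim => /eqP <-; apply: dimvS; apply: vspanS.
    exact: subsetT.
  apply: vspan_sub => i _; apply: contraT => iA.
  have fiA := vfreeU1 fA iA.
  have := Amax (i |: A); rewrite inE fiA subsetUr => /(_ isT isT) E.
  by rewrite memv_vspan // -E setU11 in iA.
have [fA sA] := is_vbasisP bA; split; first by rewrite inE.
move=> X; rewrite inE => fX AX; apply/esym/eqP; rewrite eqEcard AX /=.
move: fX; rewrite vfree_dim => /eqP <-; rewrite (is_vbasis_card bA).
by apply: dimvS; apply: vspanS; apply: subsetT.
Qed.

Lemma dual_disjoint X :
  X \in dual_matroid M -> exists2 A, is_vbasis v T A & X \subset ~: A.
Proof.
by rewrite inE => /exists_inP[A]; rewrite bases_vbasis; exists A.
Qed.

Lemma disjoint_dual X A : is_vbasis v T A -> X \subset ~: A -> X \in dual_matroid M.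
Proof.
by move=> bA XA; rewrite inE; apply/exists_inP; exists A; rewrite ?bases_vbasis.
Qed.

Lemma bases_dual B : (B \in bases (dual_matroid M)) = is_vbasis v T (~: B).
Proof.
rewrite [LHS]inE; apply/maxsetP/idP => [[]|bA].
  move=> /dual_disjoint[A bA BA] Bmax; suff -> : ~: B = A by [].
  have := Bmax _ (disjoint_dual bA (subxx _)) BA.
  by move=> <-; rewrite setCK.
split; first by apply: disjoint_dual bA _; rewrite setCK.
move=> X /dual_disjoint[A' bA' XA'] BX; apply/eqP; rewrite eq_sym eqEcard BX /=.
apply: leq_trans (subset_leq_card XA') _.
rewrite -(leq_add2l #|A'|) cardsC (is_vbasis_card bA') -(is_vbasis_card bA) addnC.
by rewrite cardsC.
Qed.

Lemma circuit_dep C : C \in circuits M -> ~~ vfree v C.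
Proof. by rewrite inE => /minsetp; rewrite inE. Qed.

Lemma circuit_min C X : C \in circuits M -> X \subset C -> ~~ vfree v X -> X = C.
Proof. by rewrite inE => /minsetP[_ H] XC nX; apply: H => //; rewrite inE. Qed.

Lemma circuit_span C x : C \in circuits M -> x \in C -> v x \in vspan v (C :\ x).
Proof.
move=> cC xC; apply: contraT => nx.
have fx : vfree v (C :\ x).
  apply: contraT => /(circuit_min cC (subsetDl _ _)) E.
  by have := xC; rewrite -E !inE eqxx.
by have := circuit_dep cC; rewrite -(setD1K xC) vfreeU1.
Qed.

Section Basis.
Variable A : {set I}.
Hypothesis bA : is_vbasis v T A.
Let fA : vfree v A. Proof. by case/is_vbasisP: bA. Qed.

Let disj1 b : b \notin A -> [disjoint A & [set b]].
Proof. by rewrite disjoint_sym disjoints1. Qed.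

Let CT (C : {set I}) : forall b, b \in C -> v b \in T.
Proof. by move=> b _; apply: vspanT. Qed.

Lemma fund_circuitP b : b \notin A -> flat v A [set b] \in circuits M.
Proof.
move=> bnA; rewrite inE; apply/minsetP.
have bF := is_vbasis_flat bA (@CT [set b]); have [_ sF] := is_vbasisP bF.
have bs : v b \in vspan v (flat v A [set b]).
  by apply: memv_vspan; rewrite inE set11.
have bnr : b \notin reach v A [set b] by apply: contra bnA; apply/subsetP/reach_sub.
split.
  by rewrite inE; apply/negP => /(vfreeU1_notin bnr); rewrite sF bs.
move=> X; rewrite inE => nX XF; apply/eqP; rewrite eqEsubset XF /=.
apply/subsetP => a aF; apply: contraT => aX.
case/setUP: aF => [/set1P E|ar].
  move/negP: nX => []; apply: vfreeS fA; apply/subsetP => i iX.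
  have := subsetP XF i iX; rewrite !inE => /orP[/eqP E'|/andP[]//].
  by rewrite E -E' iX in aX.
move/negP: nX => [].
have ca : vcoef v A (v b) a != 0.
  by move: ar; rewrite inE => /andP[_ /exists_inP[b' /set1P->]].
have : is_vbasis v (vspan v (flat v A [set b])) (b |: (reach v A [set b] :\ a)).
  apply: is_vbasis_exchange => //.
  by rewrite (vcoef_sub (A := A)) ?reach_sub ?sF.
case/is_vbasisP => + _; apply: vfreeS; apply/subsetP => i iX.
have := subsetP XF i iX; rewrite in_setU in_setU1 in_setD1 in_set1.
by case/orP => [->//|->]; rewrite andbT (contraNneq _ aX) ?orbT // => <-.
Qed.

Lemma fund_circuit_unique b C :
  b \notin A -> C \in circuits M -> C \subset b |: A -> C = flat v A [set b].
Proof.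
move=> bnA cC CbA.
have sub i : i \in C -> i != b -> i \in A.
  by move=> iC ib; have := subsetP CbA i iC; rewrite in_setU1 (negPf ib).
have bC : b \in C.
  apply: contraT => bC; case/negP: (circuit_dep cC); apply: vfreeS fA.
  by apply/subsetP => i iC; apply: sub => //; apply: contraNneq bC => <-.
apply/esym/(circuit_min cC); last by apply: circuit_dep; apply: fund_circuitP.
rewrite subUset sub1set bC /=; apply/subsetP => a; rewrite inE => /andP[aA].
case/exists_inP => _ /set1P->; apply: contraR => aC; apply/eqP.
apply: (vcoef_span0 (Z := C :\ b)); last exact: circuit_span.
move=> i; rewrite in_setD1 => /andP[ib iC]; rewrite vcoef_in //; last exact: sub.
by case: eqP aC => // ->; rewrite iC.
Qed.

Lemma fund_circuitE B b :
  B = ~: A -> b \in B -> fund_circuit M B b = flat v A [set b].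
Proof.
move=> BA bB; have bnA : b \notin A by move: bB; rewrite BA inE.
rewrite /fund_circuit BA setCK; case: pickP => [C /andP[cC]|].
  exact: fund_circuit_unique.
by move/(_ (flat v A [set b])); rewrite fund_circuitP //= setUS ?reach_sub.
Qed.

(** An element [j] of [A] on a circuit [X] inside [A :|: C] has a nonzero
    coordinate on some other element of [X], as [v j] is in their span; this
    element cannot be in [A]. *)
Lemma circuit_union_flat C :
  [disjoint A & C] -> circuit_union M (A :|: C) = flat v A C.
Proof.
move=> dAC; apply/eqP; rewrite eqEsubset; apply/andP; split.
  apply/bigcupsP => X /andP[cX XAC]; apply/subsetP => j jX; rewrite inE.
  have [//|jC] := boolP (j \in C); have jA : j \in A.
    by have := subsetP XAC j jX; rewrite inE (negPf jC) orbF.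
  rewrite inE jA /=; apply: contraT => /exists_inPn H.
  have := vcoef_in fA jA jA; rewrite eqxx.
  rewrite (vcoef_span0 (Z := X :\ j)); last exact: circuit_span.
    by move/eqP; rewrite eq_sym oner_eq0.
  move=> i; rewrite in_setD1 => /andP[ij /(subsetP XAC)].
  rewrite inE => /orP[iA|/H]; last by rewrite negbK => /eqP.
  by rewrite vcoef_in // eq_sym (negPf ij).
have sub b : b \in C -> flat v A [set b] \subset circuit_union M (A :|: C).
  move=> bC; have bnA : b \notin A by rewrite (disjointFl dAC bC).
  rewrite /circuit_union; apply: (bigcup_max (flat v A [set b])) => //.
  rewrite fund_circuitP //= subUset sub1set !inE bC orbT /=.
  exact: subset_trans (reach_sub _ _ _) (subsetUl _ _).
apply/subsetP => i /setUP[iC|].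
  by apply: (subsetP (sub i iC)); rewrite inE set11.
rewrite inE => /andP[iA /exists_inP[b bC cb]]; apply: (subsetP (sub b bC)).
by rewrite !inE iA orbC; apply/orP; left; apply/exists_inP; exists b; rewrite ?set11.
Qed.

End Basis.

Lemma Tflat_circuit_union X : circuit_union M X != set0 -> Tflat M (circuit_union M X).
Proof.
move=> n0; rewrite /Tflat n0 /=; apply/existsP.
exists [set C in circuits M | C \subset X]; apply/andP; split.
  by apply/subsetP => C; rewrite inE => /andP[].
by apply/eqP; rewrite /cover; apply: eq_bigl => C; rewrite [RHS]in_set.
Qed.

Lemma Tflat_noncoloop J x : Tflat M J -> x \in J -> v x \in vspan v (J :\ x).
Proof.
case/andP => _ /existsP[F /andP[/subsetP FM /eqP->]] /bigcupP[C CF xC].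
apply: (subvP (vspanS v _) _ (circuit_span (FM C CF) xC)).
by apply: setSD; apply: (bigcup_max C).
Qed.

Lemma Tflat_card J : Tflat M J -> (\dim (vspan v J) < #|J|)%N.
Proof.
move=> tJ; have /andP[/set0Pn[x xJ] _] := tJ.
rewrite (cardsD1 x) xJ add1n ltnS; apply: leq_trans (dim_vspan v _).
apply: dimvS; apply: vspan_sub => i iJ.
have [->|ix] := eqVneq i x; first exact: Tflat_noncoloop.
by apply: memv_vspan; rewrite !inE ix.
Qed.

End MatroidCoordinates.

Section BetaNbc.
Variables (k : fieldType) (V : vectType k) (n : nat) (v : 'I_n.+1 -> V).
Implicit Types (A B C X : {set 'I_n.+1}).
Local Notation M := (vmatroid v).
Local Notation T := (vspan v [set: 'I_n.+1]).

Lemma min_eltP A : A != set0 -> min_elt A \in A /\ forall i, i \in A -> (min_elt A <= i)%N.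
Proof.
case/set0Pn => i0 i0A; have [j jA jmin] := arg_minnP (fun i : 'I_n.+1 => i : nat) i0A.
rewrite /min_elt /arg_min /extremum; case: pickP => [i /andP[iA /forall_inP imin]|/(_ j)].
  by split.
rewrite /= [j \in A]jA /= => /negbT/forall_inPn[i iA]; rewrite -ltnNge => ij.
by have := jmin i iA; rewrite leqNgt ij.
Qed.

Lemma max_eltP A : A != set0 -> max_elt A \in A /\ forall i, i \in A -> (i <= max_elt A)%N.
Proof.
case/set0Pn => i0 i0A; have [j jA jmax] := arg_maxnP (fun i : 'I_n.+1 => i : nat) i0A.
rewrite /max_elt /arg_max /extremum; case: pickP => [i /andP[iA /forall_inP imax]|/(_ j)].
  by split.
rewrite /= [j \in A]jA /= => /negbT/forall_inPn[i iA]; rewrite -ltnNge => ij.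
by have := jmax i iA; rewrite /= leqNgt ij.
Qed.

(** Both conditions say that no [a] in [A] is the smallest element of its
    fundamental cocircuit, which consists of [a] and the [b] in [B] such that [v b]
    has a nonzero coordinate on [a]. *)
Lemma broken_circuitsP A B : B = ~: A -> is_vbasis v T A ->
  [forall X in broken_circuits (dual_matroid M), ~~ (X \subset B)] =
  [forall a in A, [exists b in B, (b < a)%N && (vcoef v A (v b) a != 0)]].
Proof.
move=> BA bA; have [fA sA] := is_vbasisP bA.
have BinA b : b \in B -> b \notin A by rewrite BA inE.
have dualB : B \in dual_matroid M by apply: disjoint_dual bA _; rewrite BA.
have exch a b : a \in A -> b \in B -> vcoef v A (v b) a != 0 ->
    forall X, X \subset a |: B -> b \notin X -> X \in dual_matroid M.
  move=> aA bB cb X XaB bX.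
  apply: (@disjoint_dual _ _ _ _ _ (b |: (A :\ a))).
    by apply: is_vbasis_exchange => //; [apply: BinA | apply: vspanT].
  apply/subsetP => i iX; have := subsetP XaB i iX.
  have ib : i != b by apply: contraNneq bX => <-.
  by rewrite BA !inE (negPf ib) /= => /orP[->//|/negPf->]; rewrite andbF.
apply/forall_inP/forall_inP => H.
  move=> a aA.
  have ndual : a |: B \notin dual_matroid M.
    apply/negP => /dual_disjoint[A' bA' sub].
    have A'A : A' \subset A :\ a.
      apply/subsetP => i iA'; have := subsetP sub i; rewrite !inE iA' BA inE.
      by case: (i == a) => //=; case: (i \in A) => //= /(_ isT).
    have := subset_leq_card A'A; rewrite leqNgt (is_vbasis_card bA') -(is_vbasis_card bA).
    by rewrite [#|A|](cardsD1 a) aA ltnS leqnn.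
  have [C mC CaB] := minset_exists (P := fun X => X \notin dual_matroid M) ndual.
  have Cdep : C \notin dual_matroid M := minsetp mC.
  have C0 : C != set0.
    apply: contraNneq Cdep => ->; apply: disjoint_dual bA _; exact: sub0set.
  have [mC1 mC2] := min_eltP C0.
  have aC : a \in C.
    apply: contraNT Cdep => aC; apply: disjoint_dual bA _; rewrite -BA.
    apply/subsetP => i iC; have := subsetP CaB i iC; rewrite in_setU1 => /orP[/eqP E|//].
    by rewrite -E iC in aC.
  have mC3 : min_elt C != a.
    apply/negP => /eqP E; have mC' : C \in circuits (dual_matroid M) by rewrite inE.
    have /negP[] := H _ (imset_f _ mC').
    rewrite E; apply/subsetP => i; rewrite in_setD1 => /andP[ia /(subsetP CaB)].
    by rewrite in_setU1 (negPf ia).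
  have mB : min_elt C \in B.
    by have := subsetP CaB _ mC1; rewrite in_setU1 (negPf mC3).
  apply/exists_inP; exists (min_elt C) => //.
  rewrite ltn_neqAle mC2 // (inj_eq val_inj) mC3 /=; apply/negP => /eqP c0.
  (* Every element outside [C], and also [min_elt C], has coordinate 0 on [a], yet
     together they contain a basis. *)
  have [A'' bA'' sub] : exists2 A'', is_vbasis v T A'' & C :\ min_elt C \subset ~: A''.
    apply: dual_disjoint; apply: contraT => nd.
    have /minsetP[_ /(_ _ nd (subsetDl _ _))] := mC.
    by move/setP/(_ (min_elt C)); rewrite !inE eqxx mC1.
  have := vcoef_in fA aA aA; rewrite eqxx (vcoef_span0 (Z := A'')).
  - by move/eqP; rewrite eq_sym oner_eq0.
  - move=> i iA''; have [->//|im] := eqVneq i (min_elt C).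
    have iC : i \notin C.
      apply/negP => iC; have := subsetP sub i; rewrite !inE im iC iA''.
      by move/(_ isT).
    have [iA|iA] := boolP (i \in A).
      by rewrite vcoef_in //; case: eqP iC => // <-; rewrite aC.
    apply/eqP; apply: contraNT Cdep => ci; apply: exch CaB iC => //.
    by rewrite BA inE.
  by have [_ ->] := is_vbasisP bA''; apply: vspanT.
move=> X /imsetP[C mC ->]; apply/negP => CB.
rewrite inE in mC; have Cdep : C \notin dual_matroid M := minsetp mC.
have C0 : C != set0.
  apply: contraNneq Cdep => ->; apply: disjoint_dual bA _; exact: sub0set.
have [mC1 mC2] := min_eltP C0.
have CaB : C \subset min_elt C |: B by rewrite -subDset.
have aA : min_elt C \in A.
  apply: contraNT Cdep => aA; apply: disjoint_dual bA _; rewrite -BA.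
  apply: subset_trans CaB _; rewrite subUset subxx andbT sub1set BA inE //.
have /exists_inP[b bB /andP[ba cb]] := H _ aA.
case/negP: Cdep; apply: exch cb _ CaB _ => //.
by apply: contraL ba => /mC2; rewrite leqNgt.
Qed.

Lemma beta_nbcE B : (B \in beta_nbc M) = beta_pair v (~: B) B.
Proof.
rewrite inE bases_dual /beta_pair setUC setUCr.
have [bA|//] := boolP (is_vbasis v T (~: B)).
rewrite (broken_circuitsP _ bA) ?setCK //=; congr (_ && _).
have key b : b \in B -> (b != min_elt (fund_circuit M B b)) =
    [exists a in ~: B, (a < b)%N && (vcoef v (~: B) (v b) a != 0)].
  move=> bB; have bnA : b \notin ~: B by rewrite inE bB.
  rewrite (fund_circuitE bA) ?setCK //.
  have bF : b \in flat v (~: B) [set b] by rewrite inE set11.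
  have [|mF1 mF2] := @min_eltP (flat v (~: B) [set b]).
    by apply/set0Pn; exists b.
  apply/idP/exists_inP => [bm|[a aA /andP[ab ca]]].
    move: mF1; rewrite in_setU in_set1 eq_sym (negPf bm) /= inE => /andP[mA].
    case/exists_inP => _ /set1P-> cm; exists (min_elt (flat v (~: B) [set b])) => //.
    by rewrite cm andbT ltn_neqAle mF2 // andbT (inj_eq val_inj) eq_sym.
  have /mF2 : a \in flat v (~: B) [set b].
    rewrite in_setU orbC; apply/orP; left; rewrite in_set aA /=.
    by apply/exists_inP; exists b; rewrite ?set11.
  by apply: contraTneq => <-; rewrite -ltnNge.
apply/forall_inP/forall_inP => H b.
  by move=> bB; apply/implyP => b0; rewrite -key //; apply: H; rewrite in_setD1 b0.
by rewrite in_setD1 => /andP[b0 bB]; rewrite key //; have /implyP := H b bB; apply.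
Qed.

End BetaNbc.

(** * Normalized vectors *)

Section WvecLine.
Variables (k : fieldType) (V : vectType k) (I : finType).
Variables (v : I -> V) (A C : {set I}) (T : {vspace V}) (b : I).
Hypotheses (bA : is_vbasis v T A) (CA : [disjoint A & C]).
Hypotheses (CT : forall b, b \in C -> v b \in T).
Hypotheses (bnA : b \notin A) (bT : v b \in T).
Local Notation D := (reach v A (b |: C) :\: reach v A C).

(** A vector of the span of the flat of [C] has coordinate zero on every element
    of [A] outside this flat, which determines all the [y a] from [y b]. *)
Lemma wvec_line (y : I -> k) :
  y b *: v b + \sum_(a in D) y a *: v a \in vspan v (flat v A C) ->
  (forall a, a \in D -> y a = - y b * vcoef v A (v b) a) /\
  y b *: v b + \sum_(a in D) y a *: v a = y b *: wvec v A C b.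
Proof.
move=> ys; have [fA sA] := is_vbasisP bA; have /is_vbasisP[_ sF] := is_vbasis_flat bA CT.
have yE a : a \in D -> y a = - y b * vcoef v A (v b) a.
  rewrite in_setD => /andP[aC aD].
  have aA : a \in A by apply: subsetP aD; apply: reach_sub.
  have : vcoef v A (y b *: v b + \sum_(a in D) y a *: v a) a = 0.
    rewrite -sF in ys; apply: vcoef_span0 ys => i ir.
    have iA : i \in A by apply: subsetP ir; apply: reach_sub.
    by rewrite vcoef_in //; case: eqP aC => // ->; rewrite ir.
  rewrite vcoefD vcoefZ vcoef_sum (bigD1 a) ?in_setD ?aC //= vcoefZ.
  rewrite (vcoef_in fA aA aA) eqxx mulr1 big1 ?addr0 => [/eqP|i /andP[]].
    by rewrite addrC addr_eq0 mulNr => /eqP.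
  rewrite in_setD => /andP[_ /(subsetP (reach_sub _ _ _)) iA] ia.
  by rewrite vcoefZ vcoef_in // eq_sym (negPf ia) mulr0.
split=> //; rewrite (wvecE bA) // scalerBr; congr (_ + _).
rewrite scaler_sumr -sumrN; apply: eq_bigr => a /yE->.
by rewrite scalerA mulNr scaleNr.
Qed.

Lemma wvec_diff_coef a : a \in D -> vcoef v A (v b) a != 0.
Proof.
rewrite in_setD => /andP[]; rewrite !inE => aC /andP[aA]; rewrite aA /= in aC.
case/exists_inP => b'; rewrite in_setU1 => /orP[/eqP->//|b'C cb].
by case/negP: aC; apply/exists_inP; exists b'.
Qed.

End WvecLine.

(** * Enumeration of a set of ordinals *)

Section OrdinalEnum.
Variable n : nat.
Implicit Types (B : {set 'I_n.+1}).
Local Notation ltI := (fun i j : 'I_n.+1 => (i < j)%N).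

Lemma enum_sorted B : sorted ltI (enum B).
Proof.
have tr : transitive ltI by move=> i j h; apply: ltn_trans.
rewrite /enum_mem -enumT /=; apply: sorted_filter => //.
by have := iota_ltn_sorted 0 n.+1; rewrite -val_enum_ord sorted_map.
Qed.

Lemma in_take_enum B i b : (i < #|B|)%N ->
  (b \in take i (enum B)) = (b \in B) && (b < nth ord0 (enum B) i)%N.
Proof.
move=> iB; have [bB|bB] := boolP (b \in B); last first.
  by apply/negbTE; apply: contra bB => /mem_take; rewrite mem_enum.
have tr : transitive ltI by move=> j1 j2 j3; apply: ltn_trans.
have bE : b \in enum B by rewrite mem_enum.
have si : i \in [pred m | (m < size (enum B))%N] by rewrite inE -cardE.
have sb : index b (enum B) \in [pred m | (m < size (enum B))%N].
  by rewrite inE index_mem.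
have lt := sorted_ltn_nth tr ord0 (enum_sorted B).
rewrite in_take //; case: (ltngtP (index b (enum B)) i) => h /=.
- by have := lt _ _ sb si h; rewrite nth_index.
- by have := lt _ _ si sb h; rewrite nth_index // => /ltnW; rewrite leqNgt => /negbTE.
by rewrite -h nth_index // ltnn.
Qed.

Lemma nth_enum_mem B i : (i < #|B|)%N -> nth ord0 (enum B) i \in B.
Proof. by move=> iB; rewrite -mem_enum mem_nth // -cardE. Qed.

Lemma enum_ord0 B : ord0 \in B -> enum B = ord0 :: behead (enum B).
Proof.
move=> B0; have B1 : (0 < #|B|)%N by rewrite (cardsD1 ord0) B0.
case E : (enum B) => [|b s]; first by move: B1; rewrite cardE E.
congr (_ :: _); apply/val_inj => /=.
have := in_take_enum ord0 B1; rewrite take0 in_nil B0 E /=.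
by move/esym/negbT; rewrite -leqNgt leqn0 => /eqP.
Qed.

Lemma prod_enum_ord0 (R : comRingType) B (F : 'I_n.+1 -> R) : ord0 \in B ->
  \prod_(b in B | b != ord0) F b =
  \prod_(i < #|B|.-1) F (nth ord0 (enum B) i.+1).
Proof.
move=> B0; have E := enum_ord0 B0.
rewrite -big_enum_cond /= cardE; have := enum_uniq (mem B); rewrite E.
set s := behead _; rewrite big_cons eqxx /= => /andP[s0 _].
rewrite big_seq_cond (eq_bigl (fun b => b \in s)); last first.
  move=> b; case: (boolP (b \in s)) => //= bs.
  by apply: contraNneq s0 => <-.
by rewrite -big_seq (big_nth ord0) big_mkord.
Qed.

End OrdinalEnum.

(** * The multiplicity space and its basis *)

Section Transfer.
Variables (k : fieldType) (U W : vectType k) (n : nat).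
Variables (e : n.+1.-tuple U) (phi : 'Hom(U, W)).
Local Notation I := 'I_n.+1.
Local Notation S := [set: I].
Local Notation VS := (subvs_of (Vspan e phi S)).
Local Notation l := (level e phi S).
Local Notation M := (repr_matroid e phi).
Local Notation R := {mpoly k[\dim {:VS}]}.
Local Notation lf := (@linear_form k VS).
Implicit Types (A B C J D : {set I}).

Definition phiS (i : I) : VS := vsproj (Vspan e phi S) (phi (tnth e i)).
Local Notation v := phiS.
Local Notation T := (vspan v S).

Lemma val_phiS i : vsval (v i) = phi (tnth e i).
Proof.
by rewrite vsprojK // (@memv_vspan _ _ _ (fun i => phi (tnth e i)) S).
Qed.

Lemma val_phiS_sum (P : pred I) (y : I -> k) :
  vsval (\sum_(i | P i) y i *: v i) = phi (\sum_(i | P i) y i *: tnth e i).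
Proof.
rewrite !linear_sum; apply: eq_bigr => i _.
by rewrite !linearZ /= val_phiS.
Qed.

Lemma mem_Vspan D (x : VS) : (vsval x \in Vspan e phi D) = (x \in vspan v D).
Proof.
apply/idP/idP => [/(@vspanP _ _ _ (fun i => phi (tnth e i)))|/vspanP] [c E].
  apply/vspanP; exists c; apply: val_inj; rewrite /= val_phiS_sum E linear_sum.
  by apply: eq_bigr => i _; rewrite linearZ.
apply/(@vspanP _ _ _ (fun i => phi (tnth e i))); exists c.
by rewrite E val_phiS_sum linear_sum; apply: eq_bigr => i _; rewrite linearZ.
Qed.

Lemma dim_Vspan D : \dim (Vspan e phi D) = \dim (vspan v D).
Proof.
pose g : 'Hom(VS, W) := linfun vsval.
have -> : Vspan e phi D = (g @: vspan v D)%VS.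
  rewrite limg_span -map_comp; congr span; apply: eq_map => i /=.
  by rewrite lfunE /= val_phiS.
apply: limg_dim_eq; have /eqP-> : lker g == 0%VS.
  by apply/lker0P => x y; rewrite !lfunE /= => /val_inj.
by rewrite capv0.
Qed.

Lemma repr_matroidE : M = vmatroid v.
Proof.
apply/setP => X; rewrite !inE vfree_dim -dim_Vspan.
exact: (@vfree_dim _ _ _ (fun i => phi (tnth e i))).
Qed.

Lemma levelE J : level e phi J = (#|J| - \dim (vspan v J) - 1)%N.
Proof. by rewrite /level dim_Vspan. Qed.

Lemma card_Tflat J : Tflat M J -> #|J| = (\dim (vspan v J) + (level e phi J).+1)%N.
Proof.
rewrite repr_matroidE => /Tflat_card tJ; rewrite levelE subn1 prednK ?subn_gt0 //.
by rewrite subnKC // ltnW.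
Qed.

Lemma sym_prodE (m : nat) (w : 'I_m -> VS) :
  mpoly_of_dhomog (sym_prod w) = \prod_(i < m) lf (w i).
Proof. by []. Qed.

(** The first T-flat of a chain is a circuit, and each following one adds to the
    previous one a set whose rank contribution is one less than its size: this is
    what [internal_circuit] and [internal_step] require. *)
Lemma generator_internal (x : Sym VS l) :
  mult_generator x -> internal v S (mpoly_of_dhomog x).
Proof.
move=> [J [w [[JT Jprop JS] wJ ->]]]; rewrite sym_prodE.
have cJ i : (i <= l)%N -> #|J i| = (\dim (vspan v (J i)) + i.+1)%N.
  by move=> il; have [tJ lJ] := JT i il; rewrite (card_Tflat tJ) lJ.
have ncl i x' : (i <= l)%N -> x' \in J i -> v x' \in vspan v (J i :\ x').
  by move=> /JT[+ _]; rewrite repr_matroidE; apply: Tflat_noncoloop.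
have main i : (i <= l)%N ->
    internal v (J i) (\prod_(m < l | (m < i)%N) lf (w m)).
  elim: i => [|i IH] il.
    rewrite big_pred0 => [|//]; apply: internal_circuit => [x'|].
      exact: ncl.
    by rewrite cJ // addn1.
  pose i0 := Ordinal il.
  rewrite (bigD1 i0) //= mulrC (eq_bigl (fun m : 'I_l => (m < i)%N)); last first.
    move=> m; rewrite -(inj_eq val_inj) /= ltnS.
    by rewrite [(m < i)%N]ltn_neqAle andbC.
  have := wJ i0; rewrite memv_cap !mem_Vspan => /andP[w1 w2].
  apply: (internal_step _ _ _ w1 w2 (IH (ltnW il))).
  - exact: proper_sub (Jprop i il).
  - by rewrite !cJ // ?(ltnW il) // !addnS addnCA.
  by move=> x'; rewrite in_setD => /andP[_]; apply: ncl.
have := main l (leqnn l); rewrite JS (eq_bigl predT) // => m.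
exact: ltn_ord.
Qed.

Lemma span_internal (x : Sym VS l) :
  lin_span (@mult_generator _ _ _ _ e phi) x -> internal v S (mpoly_of_dhomog x).
Proof.
move=> [m [c [y [yg ->]]]] i iS; rewrite linear_sum; apply: inspan_sum => j _.
by rewrite linearZ; apply: inspanZ; apply: generator_internal (yg j) i iS.
Qed.

Section BetaElement.
Variable B : {set I}.
Hypothesis betaB : B \in beta_nbc M.
Local Notation A := (~: B).
Local Notation first i := [set b in take i.+1 (enum B)].

Let nB : beta_pair v A B. Proof. by rewrite -beta_nbcE -repr_matroidE. Qed.
Let bA : is_vbasis v T A.
Proof. by have /and3P[] := nB; rewrite setUC setUCr. Qed.
Let B0 : ord0 \in B. Proof. by have := beta_pair_ord0 nB; rewrite inE negbK. Qed.

Lemma level_beta : l = #|B|.-1.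
Proof.
rewrite levelE cardsT card_ord -(is_vbasis_card bA) subn1; congr _.-1.
by have E := cardsC B; rewrite card_ord in E; rewrite -[X in (X - _)%N]E addnK.
Qed.

Let lB i : (i <= l)%N -> (i < #|B|)%N.
Proof. by rewrite level_beta -ltnS prednK //; apply/card_gt0P; exists ord0. Qed.

Let firstB i : first i \subset B.
Proof. by apply/subsetP => b; rewrite inE => /mem_take; rewrite mem_enum. Qed.

Let dfirst i : [disjoint A & first i].
Proof. by rewrite disjoint_sym disjoints_subset setCK. Qed.

Let fT C : forall b, b \in C -> v b \in T. Proof. by move=> b _; apply: vspanT. Qed.

Lemma nbc_flatE i : nbc_flat M B i = flat v A (first i).
Proof.
rewrite -(circuit_union_flat bA) // repr_matroidE /nbc_flat; congr circuit_union.
apply/setP => b; rewrite !inE; have [bB|bB] := boolP (b \in B); last first.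
  by apply: contra bB => /mem_drop; rewrite mem_enum.
have := enum_uniq (mem B); rewrite -{1}(cat_take_drop i.+1 (enum B)) cat_uniq.
case/and3P => _ /hasPn H _; move: bB; rewrite -mem_enum -{1}(cat_take_drop i.+1 (enum B)) mem_cat.
by case: (boolP (b \in take _ _)) => //= [bt _|bt ->//]; apply/negP => /H; rewrite bt.
Qed.

Lemma card_first i : (i <= l)%N -> #|first i| = i.+1.
Proof.
move=> /lB iB; rewrite cardsE (card_uniqP _) ?take_uniq ?enum_uniq //.
by rewrite size_takel // -cardE.
Qed.

Lemma first_succ i : (i < l)%N ->
  first i.+1 = nth ord0 (enum B) i.+1 |: first i.
Proof.
move=> /lB iB; apply/setP => b; rewrite !inE (take_nth ord0) ?mem_rcons //.
by rewrite -cardE.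
Qed.

Lemma firstE i : (i < l)%N ->
  first i = [set b in B | (b < nth ord0 (enum B) i.+1)%N].
Proof. by move=> /lB iB; apply/setP => b; rewrite !inE in_take_enum. Qed.

Lemma nbc_flat_chain : Tflat_chain e phi (nbc_flat M B).
Proof.
split.
- move=> i il; split.
    have := Tflat_circuit_union (v := v) (X := ~: [set b in drop i.+1 (enum B)]).
    rewrite -repr_matroidE -/(nbc_flat M B i) => -> //; rewrite nbc_flatE.
    have : first i != set0 by rewrite -card_gt0 card_first.
    by case/set0Pn => b bF; apply/set0Pn; exists b; rewrite inE bF.
  rewrite levelE nbc_flatE (card_flat bA (dfirst i) (@fT _)) card_first //.
  by rewrite addKn subn1.
- move=> i il; rewrite !nbc_flatE; apply/properP; split.
    by apply: flatS; rewrite first_succ // subsetUr.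
  set b := nth ord0 (enum B) i.+1.
  exists b; first by rewrite first_succ // /flat !inE eqxx.
  rewrite in_setU negb_or; apply/andP; split.
    by rewrite firstE // inE ltnn andbF.
  have : b \in B by apply: nth_enum_mem; apply: lB.
  by apply: contraL => /(subsetP (reach_sub _ _ _)); rewrite inE.
rewrite nbc_flatE.
have -> : first l = B.
  apply/setP => b; rewrite inE take_oversize ?mem_enum //.
  by rewrite -cardE level_beta leqSpred.
by rewrite /flat beta_pair_reach // setUCr.
Qed.

Hypothesis he : basis_of {:U} e.

Let fe : vfree (tnth e) S.
Proof. by rewrite /vfree enum_setT -enumT map_tnth_enum (basis_free he). Qed.

Section Step.
Variable i : nat.
Hypothesis il : (i < l)%N.
Local Notation C := (first i).
Local Notation b := (nth ord0 (enum B) i.+1).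
Local Notation D := (reach v A (b |: C) :\: reach v A C).

Let bB : b \in B. Proof. exact: nth_enum_mem (lB il). Qed.
Let bnA : b \notin A. Proof. by rewrite inE bB. Qed.
Let bC : b \notin C. Proof. by rewrite firstE // inE ltnn andbF. Qed.
Let bD : b \notin D.
Proof. by apply: contra bnA => /setDP[/(subsetP (reach_sub _ _ _))]. Qed.
Let diffE : nbc_flat M B i.+1 :\: nbc_flat M B i = b |: D.
Proof. by rewrite !nbc_flatE first_succ // flat_diffE. Qed.

Let p := max_elt (b |: D).
Let pD : p \in b |: D.
Proof. by have [] := @max_eltP _ (b |: D); first by apply/set0Pn; exists b; rewrite setU11. Qed.
Let pmax j : j \in b |: D -> (j <= p)%N.
Proof.
have [|_ H] := @max_eltP _ (b |: D); first by apply/set0Pn; exists b; rewrite setU11.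
exact: H.
Qed.

Let val_span (y : I -> k) : phi (\sum_(j in b |: D) y j *: tnth e j) =
  vsval (y b *: v b + \sum_(a in D) y a *: v a).
Proof. by rewrite -val_phiS_sum big_setU1. Qed.

(** The vector sought is a multiple of the fundamental relation of [b] cut down to
    [b |: D], where all its coefficients are nonzero, in particular the one at the
    largest element. *)
Lemma normalized_exists :
  exists u, normalized_in e phi (nbc_flat M B i) (nbc_flat M B i.+1) u.
Proof.
pose d j := if j == b then 1 else - vcoef v A (v b) j.
have db : d b = 1 by rewrite /d eqxx.
have dD a : a \in D -> d a = - vcoef v A (v b) a.
  by move=> aD; rewrite /d ifN //; apply: contraTneq aD => ->; apply: bD.
have d0 : d p != 0.
  have := pD; rewrite in_setU1 => /orP[/eqP->|aD]; first by rewrite db oner_eq0.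
  by rewrite dD // oppr_eq0; apply: wvec_diff_coef aD.
pose y j := d j / d p.
have yp : y p = 1 by rewrite /y divff.
exists (\sum_(j in b |: D) y j *: tnth e j); rewrite /normalized_in diffE -/p.
split.
- exists (fun j => if j \in b |: D then y j else 0).
  rewrite (bigD1 p) //= yp scale1r; congr (_ + _).
  rewrite big_mkcond [RHS]big_mkcond; apply: eq_bigr => j _ /=.
  have [/pmax jp|_] := boolP (j \in b |: D); last by rewrite scale0r if_same.
  by rewrite ltn_neqAle jp andbT (inj_eq val_inj).
- by apply/(vspanP (tnth e)); exists y.
rewrite val_span memv_cap !mem_Vspan.
have -> : y b *: v b + \sum_(a in D) y a *: v a = (d p)^-1 *: wvec v A C b.
  rewrite (wvecE bA) // ?vspanT // scalerBr /y db mul1r; congr (_ + _).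
  rewrite scaler_sumr -sumrN; apply: eq_bigr => a /dD->.
  by rewrite scalerA mulrC mulrN scaleNr.
rewrite -diffE !nbc_flatE first_succ // !memvZ //; first exact: wvec_span_flat.
by apply: (wvec_span_diff bA) => //; apply: vspanT.
Qed.

Lemma nbc_vectorP :
  normalized_in e phi (nbc_flat M B i) (nbc_flat M B i.+1) (nbc_vector e phi B i).
Proof.
have [u uN] := normalized_exists.
exact: (classical_sets.xgetI
  (P := normalized_in e phi (nbc_flat M B i) (nbc_flat M B i.+1)) 0 uN).
Qed.

(** The scalar is the coefficient at [b], which determines the coefficient 1 at
    the largest element, hence is not zero. *)
Lemma nbc_vector_line : exists2 c : k, c != 0 &
  vsproj (Vspan e phi S) (phi (nbc_vector e phi B i)) = c *: wvec v A C b.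
Proof.
have [] := nbc_vectorP; rewrite diffE -/p; set u := nbc_vector e phi B i.
move=> [x ux] /(vspanP (tnth e))[y uy] /=.
have yp : y p = 1.
  have E (z : I -> k) (P : pred I) :
      vcoef (tnth e) S (\sum_(j | P j) z j *: tnth e j) p = if P p then z p else 0.
    rewrite vcoef_sum; under eq_bigr do rewrite vcoefZ vcoef_in ?inE //.
    rewrite big_mkcond (bigD1 p) //= eqxx mulr1 big1 ?addr0 // => j jp.
    by rewrite eq_sym (negPf jp) mulr0 if_same.
  have := E y (mem (b |: D)); rewrite /= pD -uy ux vcoefD E ltnn addr0 => <-.
  by rewrite vcoef_in ?inE ?eqxx.
rewrite uy val_span memv_cap !mem_Vspan => /andP[_].
rewrite nbc_flatE => /(wvec_line bA (@fT C) (vspanT v b))[yD ->].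
exists (y b); last by rewrite vsvalK.
apply: contraTneq (oner_neq0 k) => yb; rewrite negbK -yp.
have := pD; rewrite in_setU1 => /orP[/eqP->|/yD->]; first by rewrite yb.
by rewrite yb oppr0 mul0r.
Qed.

End Step.

Lemma nbc_element_generator : mult_generator (nbc_element e phi B).
Proof.
exists (nbc_flat M B), (fun i : 'I_l => vsproj (Vspan e phi S) (phi (nbc_vector e phi B i))).
split=> [|i|//]; first exact: nbc_flat_chain.
have [_ uD uV] := nbc_vectorP (ltn_ord i).
rewrite vsprojK //; move: uV; rewrite memv_cap => /andP[+ _].
apply/subvP; exact: (vspanS (fun i => phi (tnth e i)) (subsetT _)).
Qed.

Lemma nbc_element_beta_prod : exists2 c : k, c != 0 &
  mpoly_of_dhomog (nbc_element e phi B) = c *: beta_prod v A B.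
Proof.
have /fin_all_exists2[c c0 cE] : forall i : 'I_l, exists2 c : k, c != 0 &
    vsproj (Vspan e phi S) (phi (nbc_vector e phi B i)) =
    c *: wvec v A (first i) (nth ord0 (enum B) i.+1).
  by move=> i; apply: nbc_vector_line.
exists (\prod_(i < l) c i); first by apply/prodf_neq0 => i _.
rewrite sym_prodE /beta_prod prod_enum_ord0 // -level_beta -scaler_prod.
apply: eq_bigr => i _; rewrite cE linearZ /=; congr (_ *: lf (wvec _ _ _ _)).
by rewrite -firstE.
Qed.

End BetaElement.
End Transfer.

Theorem theorem5p2 (k : fieldType) (U W : vectType k) (n : nat)
    (e : n.+1.-tuple U) (he : basis_of {:U} e) (phi : 'Hom(U, W)) :
  is_basis (beta_nbc (repr_matroid e phi)) (nbc_element e phi)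
           (@mult_space k U W n e phi).
Proof.
pose v := phiS e phi.
have SE : below n n.+1 = [set: 'I_n.+1] by apply/setP => i; rewrite !inE ltn_ord.
have betaE B : beta_below n.+1 v (~: B) = (B \in beta_nbc (repr_matroid e phi)).
  by rewrite repr_matroidE beta_nbcE /beta_below SE subsetT setTD setCK.
have sumE (F : {set 'I_n.+1} -> {mpoly k[\dim {:subvs_of (Vspan e phi [set: 'I_n.+1])}]}) :
    \sum_(Z | beta_below n.+1 v Z) F Z = \sum_(B in beta_nbc (repr_matroid e phi)) F (~: B).
  by rewrite (reindex_inj (@setC_inj _)); apply: eq_bigl => B; rewrite betaE.
have xE B : beta_prod_below n.+1 v (~: B) = beta_prod v (~: B) B.
  by rewrite /beta_prod_below SE setTD setCK.
have /fin_all_exists[c cE] : forall B, exists c : k, B \in beta_nbc (repr_matroid e phi) ->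
    c != 0 /\ mpoly_of_dhomog (nbc_element e phi B) = c *: beta_prod v (~: B) B.
  move=> B; have [bB|_] := boolP (B \in beta_nbc (repr_matroid e phi)); last by exists 0.
  by have [c c0 E] := nbc_element_beta_prod bB he; exists c.
have valE a : mpoly_of_dhomog (\sum_(B in beta_nbc (repr_matroid e phi))
      a B *: nbc_element e phi B) =
    \sum_(B in beta_nbc (repr_matroid e phi)) (a B * c B) *: beta_prod_below n.+1 v (~: B).
  rewrite linear_sum; apply: eq_bigr => B bB; rewrite linearZ xE -scalerA.
  by congr (_ *: _); exact: (cE _ bB).2.
split.
- move=> B bB; rewrite /mult_space.
  have [HT _ HS] := nbc_flat_chain bB; have [+ _] := HT _ (leqnn _).
  rewrite HS => ->; exists 1%N, (fun=> 1), (fun=> nbc_element e phi B).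
  by split; [move=> _; apply: nbc_element_generator | rewrite big_ord1 scale1r].
- move=> a /(congr1 (@mpoly_of_dhomog _ _ _)); rewrite linear0 valE => E B bB.
  have : a B * c B = 0.
    rewrite -{1 2}[B]setCK.
    apply: (beta_below_lin_indep (v := v) (ltnSn n)
      (c := fun Z => a (~: Z) * c (~: Z))); last by rewrite betaE.
    by rewrite sumE -[RHS]E; apply: eq_bigr => B' _; rewrite setCK.
  by move/eqP; rewrite mulf_eq0 (negPf (cE _ bB).1) orbF => /eqP.
move=> x; rewrite /mult_space; case: ifP => _ xS; last first.
  by exists (fun=> 0); rewrite xS big1 // => B _; rewrite scale0r.
have xI : internal v (below n n.+1) (mpoly_of_dhomog x).
  by rewrite SE; apply: span_internal.
have [d dE] := internal_span (ltnSn n) xI.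
exists (fun B => d (~: B) / c B); apply: val_inj.
rewrite -[LHS]/(mpoly_of_dhomog x) -[RHS]/(mpoly_of_dhomog _) dE sumE valE.
by apply: eq_bigr => B bB; rewrite divfK //; exact: (cE _ bB).1.
Qed.
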